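(* Let $v=C+Q'$ be as in the context and $bc\in\{Per^+,Per^-\}$. Let $\mathcal{F}:L^2([0,\pi])\to\ell^2(\Gamma_{Per^\pm})$ be the Fourier isomorphism $f\mapsto(f_k)_{k\in\Gamma_{Per^\pm}}$, $f_k=\frac1\pi\int_0^\pi f(x)e^{-ikx}dx$. Let $\mathcal{L}_\pm$ be the operator in $\ell^2(\Gamma_{Per^\pm})$ defined by $$\mathcal{L}_\pm(z)=(h_k(z))_{k\in\Gamma_{Per^\pm}},\qquad h_k(z)=k^2z_k+\sum_{m\in\Gamma_{Per^\pm},\,m\neq k}V(k-m)z_m+Cz_k,$$ on the domain $$D(\mathcal{L}_\pm)=\{z\in\ell^2(|k|,\Gamma_{Per^\pm}):\ \mathcal{L}_\pm(z)\in\ell^2(\Gamma_{Per^\pm})\},\quad \ell^2(|k|,\Gamma_{Per^\pm})=\{z:\ \textstyle\sum_k(1+|k|^2)|z_k|^2<\infty\}.$$ Then $D(L_{Per^\pm})=\mathcal{F}^{-1}(D(\mathcal{L}_\pm))$ and $L_{Per^\pm}=\mathcal{F}^{-1}\circ\mathcal{L}_\pm\circ\mathcal{F}$.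
   Context: $v\in H^{-1}_{loc}(\mathbb{R})$ is a $\pi$-periodic distribution written (uniquely) as $v=C+Q'$, $C\in\mathbb{C}$, $Q\in L^2_{loc}(\mathbb{R})$ $\pi$-periodic with $\int_0^\pi Q=0$; $q(m)=\frac1\pi\int_0^\pi Q(x)e^{-imx}dx$ ($m\in2\mathbb{Z}$), $V(m)=imq(m)$ for $m\neq 0$. $\Gamma_{Per^+}=2\mathbb{Z}$, $\Gamma_{Per^-}=1+2\mathbb{Z}$. $L^2([0,\pi])$ carries the inner product $\frac1\pi\int_0^\pi f\overline g$. $\ell(y)=-(y'-Qy)'-Qy'+Cy$. $L_{Per^+}$ (resp. $L_{Per^-}$) is the operator $y\mapsto\ell(y)$ in $L^2([0,\pi])$ with domain $\{y\in H^1([0,\pi]): y'-Qy\in W^1_1([0,\pi]),\ y(\pi)=\pm y(0),\ (y'-Qy)(\pi)=\pm(y'-Qy)(0),\ \ell(y)\in L^2([0,\pi])\}$ with sign $+$ (resp. $-$); $W^1_1([0,\pi])$ denotes absolutely continuous functions. *)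

(* Defs.v *)
From HB Require Import structures.
From mathcomp Require Import all_boot all_order all_algebra.
From mathcomp Require Import all_classical all_reals all_analysis.
From mathcomp Require Import complex.
Set Implicit Arguments. Unset Strict Implicit. Unset Printing Implicit Defensive.
Import Order.TTheory GRing.Theory Num.Theory.
Import numFieldNormedType.Exports.
Local Open Scope classical_set_scope.
Local Open Scope ring_scope.
Local Open Scope complex_scope.

Section Defs.
Variable R : realType.
Local Notation mu := (@lebesgue_measure R).
Local Notation Re := (@complex.Re R).
Local Notation Im := (@complex.Im R).

Definition cmeas (D : set R) (f : R -> R[i]) : Prop :=
  measurable_fun D (fun x => Re (f x)) /\ measurable_fun D (fun x => Im (f x)).

Definition L2on (D : set R) (f : R -> R[i]) : Prop :=
  cmeas D f /\
  (\int[mu]_(x in D) ((Re (f x)) ^+ 2 + (Im (f x)) ^+ 2)%:E < +oo)%E.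

Definition L1on (D : set R) (f : R -> R[i]) : Prop :=
  mu.-integrable D (fun x => (Re (f x))%:E) /\
  mu.-integrable D (fun x => (Im (f x))%:E).

Definition cint (D : set R) (f : R -> R[i]) : R[i] :=
  (Rintegral mu D (fun x => Re (f x))) +i* (Rintegral mu D (fun x => Im (f x))).

Definition cexpmi (t : R) : R[i] := (cos t) +i* (- sin t).

Definition fourier (f : R -> R[i]) (k : int) : R[i] :=
  (pi^-1)%:C * cint `[0, pi] (fun x => f x * cexpmi (k%:~R * x)).

Definition Gamma (plus : bool) : set int :=
  [set k | if plus then (2 %| k)%Z else ~~ (2 %| k)%Z].

Definition bsign (plus : bool) : R[i] := if plus then 1 else -1.

Definition csq (z : R[i]) : R := (Re z) ^+ 2 + (Im z) ^+ 2.

Definition ell2 (plus : bool) (z : int -> R[i]) : Prop :=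
  (\esum_(k in Gamma plus) (csq (z k))%:E < +oo)%E.
Definition ell2k (plus : bool) (z : int -> R[i]) : Prop :=
  (\esum_(k in Gamma plus) ((1 + (k%:~R) ^+ 2) * csq (z k))%:E < +oo)%E.

Definition symsum (a : int -> R[i]) (N : nat) : R[i] :=
  \sum_(0 <= j < (2 * N).+1) a (j%:Z - N%:Z).
Definition zseries (a : int -> R[i]) : R[i] :=
  (limn (fun N => Re (symsum a N))) +i* (limn (fun N => Im (symsum a N))).

Definition qcoef (Q : R -> R[i]) (m : int) : R[i] := fourier Q m.
Definition Vcoef (Q : R -> R[i]) (m : int) : R[i] := 'i * (m%:~R)%:C * qcoef Q m.

Definition hcoef (plus : bool) (C : R[i]) (Q : R -> R[i]) (z : int -> R[i])
    (k : int) : R[i] :=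
  ((k%:~R) ^+ 2)%:C * z k
  + zseries (fun m => if (m \in Gamma plus) && (m != k) then Vcoef Q (k - m) * z m
                      else 0)
  + C * z k.

Definition domLL (plus : bool) (C : R[i]) (Q : R -> R[i]) (z : int -> R[i]) : Prop :=
  ell2k plus z /\ ell2 plus (hcoef plus C Q z).

(* Y is absolutely continuous on [0,pi] with derivative g : Y x = Y 0 + int_0^x g *)
Definition primitive_on (Y g : R -> R[i]) : Prop :=
  forall x, 0 <= x <= pi -> Y x = Y 0 + cint `[0, x] g.

(* Witness data for y in D(L_{Per pm}):
   Y  : the absolutely continuous (H^1) representative of y, with Y' = g in L^2,
   u  : the absolutely continuous representative of y' - Q y, with u' = w in L^1,
   boundary conditions, and l(y) = -w - Q g + C Y in L^2. *)
Definition lexpr (C : R[i]) (Q : R -> R[i]) (Y g w : R -> R[i]) : R -> R[i] :=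
  fun x => - w x - Q x * g x + C * Y x.

Definition dom_witness (plus : bool) (C : R[i]) (Q : R -> R[i]) (y : R -> R[i])
    (Y g u w : R -> R[i]) : Prop :=
  [/\ L2on `[0, pi] g, primitive_on Y g &
      {ae mu, forall x, `[0, pi]%classic x -> y x = Y x}] /\
  [/\ L1on `[0, pi] w, primitive_on u w &
      {ae mu, forall x, `[0, pi]%classic x -> u x = g x - Q x * Y x}] /\
  (Y pi = bsign plus * Y 0 /\ u pi = bsign plus * u 0) /\
  L2on `[0, pi] (lexpr C Q Y g w).

Definition domL (plus : bool) (C : R[i]) (Q : R -> R[i]) (y : R -> R[i]) : Prop :=
  exists Y g u w, dom_witness plus C Q y Y g u w.

End Defs.

(* Main.v *)
(* Write [f_k] for the Fourier coefficients of [f]. If [Y' = g], [u' = w] and [u = g - Q Y], then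
   integration by parts (the boundary terms cancel for [k] in [Gamma]) gives [g_k = ik Y_k] and
   [w_k = ik u_k], so the coefficients of [l(y) = - w - Q g + C Y] are
   [k^2 Y_k + ik (Q Y)_k - (Q g)_k + C Y_k]. By Parseval, [(Q Y)_k] and [(Q g)_k] are the convolutions
   of [q] with [Y_m] and [im Y_m], and [ik - im = i(k - m)] yields the series with
   [V(k-m) = i(k-m) q(k-m)]. Conversely, if [z = (y_k)] is in the domain of [L_{pm}], Riesz-Fischer
   produces [g] with [g_k = ik z_k] and [f] with [f_k = h_k(z)]; suitable primitives [Y] of [g] and
   [u] of [- f - Q g + C Y] then have the same Fourier coefficients as [y] and [g - Q Y], hence agree
   with them almost everywhere. The uniqueness of Fourier coefficients is reduced, by integrating
   twice, to Lipschitz functions, where Chernoff's telescoping argument applies. *)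
Require Import Defs.
From HB Require Import structures.
From mathcomp Require Import all_boot all_order all_algebra.
From mathcomp Require Import all_classical all_reals all_analysis.
From mathcomp Require Import measurable_realfun complex.
From mathcomp Require Import ring lra zify.
Set Implicit Arguments. Unset Strict Implicit. Unset Printing Implicit Defensive.
Import Order.TTheory GRing.Theory Num.Theory.
Import numFieldNormedType.Exports.
Local Open Scope classical_set_scope.
Local Open Scope ring_scope.
Local Open Scope complex_scope.

(** * Complex-valued measurability, integrals and the L2 norm, taken componentwise *)

Section complex_integration.
Variable R : realType.
Local Notation mu := (@lebesgue_measure R).
Local Notation Re := (@complex.Re R).
Local Notation Im := (@complex.Im R).
Implicit Types (z w : R[i]) (D : set R) (f g h : R -> R[i]).

(** The coefficients of [w] are needed for [w] merely in L1, whose primitive need not be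
    differentiable everywhere; integration by parts is therefore obtained from Fubini on a triangle.
    Uniqueness comes before completeness: a Riesz-Fischer limit built from the coefficients of [f]
    has these same coefficients, hence equals [f] almost everywhere, and only then do the partial
    sums converge to [f] and does Parseval hold. Two integrations are used because the quotient in
    Chernoff's argument is bounded when its numerator is Lipschitz at the zero of the denominator:
    the first makes a square-integrable function bounded, the second makes a bounded one Lipschitz.
    The series in [h_k] is read as the limit of its sums over $|m| \le N$; the two Parseval sums
    converge along the same symmetric ranges, so their difference does too. The zero frequency,
    where division by $ik$ fails, exists only in the periodic case, and there the free constant of
    the primitive absorbs it; in the antiperiodic case that constant is spent on the boundary
    condition. *)

Lemma cReD z w : Re (z + w) = Re z + Re w. Proof. by case: z; case: w. Qed.
Lemma cImD z w : Im (z + w) = Im z + Im w. Proof. by case: z; case: w. Qed.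
Lemma cReN z : Re (- z) = - Re z. Proof. by case: z. Qed.
Lemma cImN z : Im (- z) = - Im z. Proof. by case: z. Qed.
Lemma cReM z w : Re (z * w) = Re z * Re w - Im z * Im w.
Proof. by case: z; case: w. Qed.
Lemma cImM z w : Im (z * w) = Re z * Im w + Im z * Re w.
Proof. by case: z; case: w => *; rewrite /= addrC. Qed.
(* A transparent conjugation: [^*] resolves to either [conjc] or [Num.conj] depending on the context. *)
Definition cj z : R[i] := Re z +i* - Im z.

Lemma cReJ z : Re (cj z) = Re z. Proof. by case: z. Qed.
Lemma cImJ z : Im (cj z) = - Im z. Proof. by case: z. Qed.

Lemma lebesgue_aeS (P P' : R -> Prop) : (forall x, P x -> P' x) ->
  {ae mu, forall x, P x} -> {ae mu, forall x, P' x}.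
Proof. by move=> PP'; apply: filterS => //; exact: (ae_filter_ringOfSetsType mu). Qed.

Definition ReImE := (cReD, cImD, cReN, cImN, cReM, cImM, cReJ, cImJ).

Lemma Re_sum I (s : seq I) (P : pred I) (F : I -> R[i]) :
  Re (\sum_(i <- s | P i) F i) = \sum_(i <- s | P i) Re (F i).
Proof. by apply: (big_morph Re) => [x y|]; [exact: cReD|]. Qed.

Lemma complex_ext z w : Re z = Re w -> Im z = Im w -> z = w.
Proof. by case: z; case: w => /= a b c d -> ->. Qed.

Lemma csq_ge0 z : 0 <= csq z.
Proof. by rewrite addr_ge0 ?sqr_ge0. Qed.

Lemma csq0 : csq (0 : R[i]) = 0.
Proof. by rewrite /csq /= expr0n /= addr0. Qed.

Lemma csq_eq0 z : csq z = 0 -> z = 0.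
Proof.
move/eqP; rewrite paddr_eq0 ?sqr_ge0// !sqrf_eq0 => /andP[/eqP a /eqP b].
exact: complex_ext.
Qed.

Lemma csqN z : csq (- z) = csq z.
Proof. by rewrite /csq !ReImE !sqrrN. Qed.

Lemma csqJ z : csq (cj z) = csq z.
Proof. by rewrite /csq !ReImE sqrrN. Qed.

Lemma csqM z w : csq (z * w) = csq z * csq w.
Proof. rewrite /csq !ReImE; ring. Qed.

Lemma csqR (a : R) : csq (a%:C) = a ^+ 2.
Proof. by rewrite /csq /= expr0n /= addr0. Qed.

Lemma csqi : csq ('i : R[i]) = 1.
Proof. by rewrite /csq /= expr0n /= add0r expr1n. Qed.

Lemma csqD_le z w : csq (z + w) <= 2 * csq z + 2 * csq w.
Proof.
rewrite /csq !ReImE.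
have := sqr_ge0 (Re z - Re w); have := sqr_ge0 (Im z - Im w); nra.
Qed.

Lemma Re_sqr_le_csq z : (Re z) ^+ 2 <= csq z.
Proof. by rewrite lerDl sqr_ge0. Qed.

Lemma Im_sqr_le_csq z : (Im z) ^+ 2 <= csq z.
Proof. by rewrite lerDr sqr_ge0. Qed.

Lemma csq_conj z : (csq z)%:C = z * cj z.
Proof. by apply: complex_ext; rewrite !ReImE /csq /=; ring. Qed.

Lemma conjK z : cj (cj z) = z.
Proof. by apply: complex_ext; rewrite !ReImE ?opprK. Qed.

Lemma conjM z w : cj (z * w) = cj z * cj w.
Proof. by apply: complex_ext; rewrite !ReImE; ring. Qed.

Lemma conjD z w : cj (z + w) = cj z + cj w.
Proof. by apply: complex_ext; rewrite !ReImE; ring. Qed.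

Lemma cmeasD D f g : cmeas D f -> cmeas D g -> cmeas D (fun x => f x + g x).
Proof.
move=> [f1 f2] [g1 g2]; split.
  by under eq_fun do rewrite cReD; exact: measurable_funD.
by under eq_fun do rewrite cImD; exact: measurable_funD.
Qed.

Lemma cmeasM D f g : cmeas D f -> cmeas D g -> cmeas D (fun x => f x * g x).
Proof.
move=> [f1 f2] [g1 g2]; split.
  under eq_fun do rewrite cReM.
  by apply: measurable_funB; apply: measurable_funM.
under eq_fun do rewrite cImM.
by apply: measurable_funD; apply: measurable_funM.
Qed.

Lemma cmeas_cst D z : cmeas D (fun=> z).
Proof. by split; exact: measurable_cst. Qed.

Lemma cmeasN D f : cmeas D f -> cmeas D (fun x => - f x).
Proof.
move=> [f1 f2]; split.
  by under eq_fun do rewrite cReN; exact: measurable_funN.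
by under eq_fun do rewrite cImN; exact: measurable_funN.
Qed.

Lemma cmeasB D f g : cmeas D f -> cmeas D g -> cmeas D (fun x => f x - g x).
Proof. by move=> mf mg; apply: cmeasD => //; exact: cmeasN. Qed.

Lemma cmeasJ D f : cmeas D f -> cmeas D (fun x => cj (f x)).
Proof.
move=> [f1 f2]; split.
  by [].
by under eq_fun do rewrite cImJ; exact: measurable_funN.
Qed.

Lemma measurable_csq D f : cmeas D f -> measurable_fun D (fun x => csq (f x)).
Proof. by move=> [f1 f2]; apply: measurable_funD; exact: measurable_funX. Qed.

Lemma L1on_cmeas D f : L1on D f -> cmeas D f.
Proof.
by move=> [/measurable_int/measurable_EFinP a /measurable_int/measurable_EFinP b].
Qed.

Section fixed_domain.
Variable D : set R.
Hypothesis mD : measurable D.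

Lemma L1on_le (b : R -> R) f : cmeas D f -> mu.-integrable D (EFin \o b) ->
  (forall x, D x -> `|Re (f x)| <= b x /\ `|Im (f x)| <= b x) -> L1on D f.
Proof.
move=> [f1 f2] ib fb; split.
  apply: le_integrable ib => //; first exact/measurable_EFinP.
  move=> x Dx /=; rewrite lee_fin; apply: le_trans (ler_norm _).
  exact: (fb x Dx).1.
apply: le_integrable ib => //; first exact/measurable_EFinP.
move=> x Dx /=; rewrite lee_fin; apply: le_trans (ler_norm _).
exact: (fb x Dx).2.
Qed.

Lemma L1onD f g : L1on D f -> L1on D g -> L1on D (fun x => f x + g x).
Proof.
move=> [f1 f2] [g1 g2]; split.
  by under eq_fun do rewrite cReD EFinD; exact: integrableD.
by under eq_fun do rewrite cImD EFinD; exact: integrableD.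
Qed.

Lemma L1onZ z f : L1on D f -> L1on D (fun x => z * f x).
Proof.
move=> [f1 f2]; split.
  under eq_fun do rewrite cReM EFinB !EFinM.
  by apply: integrableB => //; exact: integrableZl.
under eq_fun do rewrite cImM EFinD !EFinM.
by apply: integrableD => //; exact: integrableZl.
Qed.

Lemma L1onN f : L1on D f -> L1on D (fun x => - f x).
Proof. by move=> /(L1onZ (-1)); under eq_fun do rewrite mulN1r. Qed.

Lemma L1onB f g : L1on D f -> L1on D g -> L1on D (fun x => f x - g x).
Proof. by move=> If Ig; apply: L1onD => //; exact: L1onN. Qed.

Lemma cintD f g : L1on D f -> L1on D g ->
  cint D (fun x => f x + g x) = cint D f + cint D g.
Proof.
move=> [f1 f2] [g1 g2]; apply: complex_ext; rewrite ?ReImE /=.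
  by under eq_Rintegral do rewrite cReD; rewrite RintegralD.
by under eq_Rintegral do rewrite cImD; rewrite RintegralD.
Qed.

Lemma cintZ z f : L1on D f -> cint D (fun x => z * f x) = z * cint D f.
Proof.
move=> [f1 f2].
have i r (k : R -> R) : mu.-integrable D (EFin \o k) ->
    mu.-integrable D (EFin \o (fun x => r * k x)).
  by move=> ik; rewrite /comp; under eq_fun do rewrite EFinM; exact: integrableZl.
apply: complex_ext; rewrite ?ReImE /=.
  under eq_Rintegral do rewrite cReM.
  by rewrite RintegralB ?RintegralZl//; exact: i.
under eq_Rintegral do rewrite cImM.
by rewrite RintegralD ?RintegralZl//; exact: i.
Qed.

Lemma cintN f : L1on D f -> cint D (fun x => - f x) = - cint D f.
Proof.
by move=> If; rewrite -[RHS]mulN1r -cintZ//; under [in RHS]eq_fun do rewrite mulN1r.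
Qed.

Lemma cintB f g : L1on D f -> L1on D g ->
  cint D (fun x => f x - g x) = cint D f - cint D g.
Proof. by move=> If Ig; rewrite cintD ?cintN//; exact: L1onN. Qed.

Lemma L1on_sum I (s : seq I) (F : I -> R -> R[i]) :
  (forall i, L1on D (F i)) -> L1on D (fun x => \sum_(i <- s) F i x).
Proof.
move=> iF; elim: s => [|i s IHs]; last first.
  by under eq_fun do rewrite big_cons; exact: L1onD.
by under eq_fun do rewrite big_nil; split; exact: integrable0.
Qed.

Lemma cint_sum I (s : seq I) (F : I -> R -> R[i]) :
  (forall i, L1on D (F i)) ->
  cint D (fun x => \sum_(i <- s) F i x) = \sum_(i <- s) cint D (F i).
Proof.
move=> iF; elim: s => [|i s IHs]; last first.
  under eq_fun do rewrite big_cons.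
  by rewrite big_cons -IHs cintD//; exact: L1on_sum.
under eq_fun do rewrite big_nil.
by rewrite big_nil; apply: complex_ext; rewrite /= Rintegral_cst// mul0r.
Qed.

Lemma eq_cint f g : {in D, f =1 g} -> cint D f = cint D g.
Proof.
by move=> fg; apply: complex_ext => /=; apply: eq_Rintegral => x xD; rewrite fg.
Qed.

Lemma ae_eq_cint f g : cmeas D f -> cmeas D g ->
  {ae mu, forall x, D x -> f x = g x} -> cint D f = cint D g.
Proof.
move=> [f1 f2] [g1 g2] fg; apply: complex_ext; rewrite /= /Rintegral; congr fine;
  apply: ae_eq_integral => //; try exact/measurable_EFinP;
  by apply: lebesgue_aeS fg => x /[apply] ->.
Qed.

Lemma L2onP f : L2on D f <->
  cmeas D f /\ mu.-integrable D (EFin \o (fun x => csq (f x))).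
Proof.
have E : (\int[mu]_(x in D) `|(csq (f x))%:E| = \int[mu]_(x in D) (csq (f x))%:E)%E.
  by apply: eq_integral => x _; rewrite gee0_abs// lee_fin csq_ge0.
split=> [[mf fi]|[mf /integrableP[_ fi]]]; split => //.
  apply/integrableP; split; first by apply/measurable_EFinP; exact: measurable_csq.
  by rewrite [ltLHS]E.
by move: fi; rewrite [ltLHS]E.
Qed.

Lemma L2on_le (b : R -> R) f : cmeas D f -> mu.-integrable D (EFin \o b) ->
  (forall x, D x -> csq (f x) <= b x) -> L2on D f.
Proof.
move=> mf ib fb; apply/L2onP; split => //.
apply: le_integrable ib => //; first by apply/measurable_EFinP; exact: measurable_csq.
move=> x Dx /=; rewrite lee_fin ger0_norm ?csq_ge0//.
exact: le_trans (fb _ Dx) (ler_norm _).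
Qed.

Lemma L2onD f g : L2on D f -> L2on D g -> L2on D (fun x => f x + g x).
Proof.
move=> /L2onP[mf fi] /L2onP[mg gi].
apply: (@L2on_le (fun x => 2 * csq (f x) + 2 * csq (g x))).
- exact: cmeasD.
- rewrite /comp; under eq_fun do rewrite EFinD !EFinM.
  by apply: integrableD => //; exact: integrableZl.
- by move=> x _; exact: csqD_le.
Qed.

Lemma L2on_Mbounded (M : R) f g : L2on D f -> cmeas D g ->
  (forall x, D x -> csq (g x) <= M) -> L2on D (fun x => f x * g x).
Proof.
move=> /L2onP[mf fi] mg gM.
apply: (@L2on_le (fun x => M * csq (f x))).
- exact: cmeasM.
- by rewrite /comp; under eq_fun do rewrite EFinM; exact: integrableZl.
- by move=> x Dx; rewrite csqM mulrC ler_wpM2r ?csq_ge0 ?gM.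
Qed.

Lemma L2onZ z f : L2on D f -> L2on D (fun x => z * f x).
Proof.
move=> fi; under eq_fun do rewrite mulrC.
by apply: (@L2on_Mbounded (csq z)) => //; exact: cmeas_cst.
Qed.

Lemma L2onN f : L2on D f -> L2on D (fun x => - f x).
Proof. by move=> /(L2onZ (-1)); under eq_fun do rewrite mulN1r. Qed.

Lemma L2onB f g : L2on D f -> L2on D g -> L2on D (fun x => f x - g x).
Proof. by move=> If Ig; apply: L2onD => //; exact: L2onN. Qed.

Lemma L2onJ f : L2on D f -> L2on D (fun x => cj (f x)).
Proof.
move=> /L2onP[mf fi]; apply: (L2on_le (cmeasJ mf) fi) => x _.
by rewrite csqJ.
Qed.

(** The bound $|ab| \le (a^2 + b^2)/2$, applied to the real products that make up [f x * g x], gives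
    [csq (f x) + csq (g x)] as an integrable majorant. *)
Lemma L1on_ML2 f g : L2on D f -> L2on D g -> L1on D (fun x => f x * g x).
Proof.
move=> /L2onP[mf fi] /L2onP[mg gi].
apply: (@L1on_le (fun x => csq (f x) + csq (g x))).
- exact: cmeasM.
- by rewrite /comp; under eq_fun do rewrite EFinD; exact: integrableD.
- move=> x _; rewrite !ReImE /csq !ler_norml.
  have h1 := sqr_ge0 (Re (f x) - Re (g x)); have h2 := sqr_ge0 (Re (f x) + Re (g x)).
  have h3 := sqr_ge0 (Im (f x) - Im (g x)); have h4 := sqr_ge0 (Im (f x) + Im (g x)).
  have h5 := sqr_ge0 (Im (f x) - Re (g x)); have h6 := sqr_ge0 (Im (f x) + Re (g x)).
  have h7 := sqr_ge0 (Re (f x) - Im (g x)); have h8 := sqr_ge0 (Re (f x) + Im (g x)).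
  have k1 := sqr_ge0 (Re (f x)); have k2 := sqr_ge0 (Re (g x)).
  have k3 := sqr_ge0 (Im (f x)); have k4 := sqr_ge0 (Im (g x)).
  by split; apply/andP; split; nra.
Qed.

Definition norm2 f : R := Rintegral mu D (fun x => csq (f x)).

Lemma norm2_ge0 f : 0 <= norm2 f.
Proof. by apply: Rintegral_ge0 => x _; exact: csq_ge0. Qed.

Lemma norm2E f : norm2 f = Re (cint D (fun x => f x * cj (f x))).
Proof.
by rewrite /=; apply: eq_Rintegral => x _; rewrite -csq_conj.
Qed.

Lemma norm2D f g : L2on D f -> L2on D g ->
  norm2 (fun x => f x + g x) =
  norm2 f + norm2 g + 2 * Re (cint D (fun x => f x * cj (g x))).
Proof.
move=> If Ig; have [_ fi] := (L2onP f).1 If; have [_ gi] := (L2onP g).1 Ig.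
have [fg _] := L1on_ML2 If (L2onJ Ig).
have fg2 : mu.-integrable D (EFin \o (fun x => 2 * Re (f x * cj (g x)))).
  by rewrite /comp; under eq_fun do rewrite EFinM; exact: integrableZl.
have ffgg : mu.-integrable D (EFin \o (fun x => csq (f x) + csq (g x))).
  by rewrite /comp; under eq_fun do rewrite EFinD; exact: integrableD.
rewrite /norm2 /cint -RintegralD//= -RintegralZl// -RintegralD//.
by apply: eq_Rintegral => x _; rewrite /csq !ReImE; ring.
Qed.

Lemma norm2Z z f : L2on D f -> norm2 (fun x => z * f x) = csq z * norm2 f.
Proof.
move=> /L2onP[mf fi]; rewrite /norm2 -RintegralZl//.
by apply: eq_Rintegral => x _; rewrite csqM.
Qed.

Lemma norm2J f : norm2 (fun x => cj (f x)) = norm2 f.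
Proof. by apply: eq_Rintegral => x _; rewrite csqJ. Qed.

Lemma ae_eq_norm2 f g : cmeas D f -> cmeas D g ->
  {ae mu, forall x, D x -> f x = g x} -> norm2 f = norm2 g.
Proof.
move=> mf mg fg; rewrite /norm2 /Rintegral; congr fine.
apply: ae_eq_integral => //; try by apply/measurable_EFinP; exact: measurable_csq.
by apply: lebesgue_aeS fg => x /[apply] ->.
Qed.

(** Nonnegativity of the norm of [f + t c cj g] for every real [t], where [c] is the integral; the
    factor [c] turns the cross term into [2 * t * csq c]. The pairing carries no conjugate because
    Fourier coefficients occur in this form. *)
Lemma cauchy_schwarz f g : L2on D f -> L2on D g ->
  csq (cint D (fun x => f x * g x)) <= norm2 f * norm2 g.
Proof.
move=> If Ig; set c := cint _ _.
have H (t : R) : 0 <= norm2 f + t ^+ 2 * csq c * norm2 g + 2 * t * csq c.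
  have Ih : L2on D (fun x => t%:C * c * cj (g x)) by exact/L2onZ/L2onJ.
  have -> : norm2 f + t ^+ 2 * csq c * norm2 g + 2 * t * csq c =
            norm2 (fun x => f x + t%:C * c * cj (g x)).
    rewrite (norm2D If Ih) norm2Z; last exact: L2onJ.
    rewrite norm2J csqM csqR; congr (_ + _); rewrite -mulrA; congr (_ * _).
    rewrite (eq_cint (g := fun x => cj (t%:C * c) * (f x * g x))).
      rewrite cintZ ?cReM; last exact: L1on_ML2.
      by rewrite -/c /csq !ReImE /=; ring.
    by move=> x _; rewrite conjM conjK; ring.
  exact: norm2_ge0.
have := norm2_ge0 g; rewrite le_eqVlt => /predU1P[g0|g0].
  (* With [norm2 g] zero the expression is affine in [t]; if [csq c] were positive, the [t] chosen
     next would give it the value -1. *)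
  rewrite -g0 mulr0 leNgt; apply/negP => c0.
  have := H (- (norm2 f + 1) / (2 * csq c)).
  rewrite -g0 mulr0 addr0.
  have -> : 2 * (- (norm2 f + 1) / (2 * csq c)) * csq c = - (norm2 f + 1).
    by field; rewrite gt_eqF.
  by lra.
(* The value of [t] that minimises the quadratic. *)
have := H (- (norm2 g)^-1).
have -> : norm2 f + (- (norm2 g)^-1) ^+ 2 * csq c * norm2 g + 2 * - (norm2 g)^-1 * csq c =
          norm2 f - csq c / norm2 g by field; rewrite gt_eqF.
by rewrite subr_ge0 ler_pdivrMr.
Qed.

End fixed_domain.
End complex_integration.

(** * Integration by parts for the primitive of an integrable function *)

Section integration_by_parts.
Variable R : realType.
Local Notation mu := (@lebesgue_measure R).

Lemma integrable_mulr (D : set R) (h : R -> R) (r : R) : measurable D ->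
  mu.-integrable D (EFin \o h) -> mu.-integrable D (EFin \o (fun x => h x * r)).
Proof.
move=> mD ih; have -> : EFin \o (fun x => h x * r) = (fun x => (h x)%:E * r%:E)%E by [].
exact: integrableZr.
Qed.

Lemma integrable_mull (D : set R) (h : R -> R) (r : R) : measurable D ->
  mu.-integrable D (EFin \o h) -> mu.-integrable D (EFin \o (fun x => r * h x)).
Proof.
move=> mD ih; have -> : EFin \o (fun x => r * h x) = (fun x => r%:E * (h x)%:E)%E by [].
exact: integrableZl.
Qed.

Lemma continuous_segment_integrable (phi : R -> R) (a b : R) : continuous phi ->
  mu.-integrable `[a, b] (EFin \o phi).
Proof.
move=> cphi; apply: continuous_compact_integrable; first exact: segment_compact.
exact: continuous_subspaceT.
Qed.

Lemma continuous_segment_bounded (phi : R -> R) (a b : R) : continuous phi ->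
  exists2 M, 0 <= M & forall x, a <= x <= b -> `|phi x| <= M.
Proof.
move=> cphi; have [ab|ba] := leP a b; last first.
  by exists 0 => // x /andP[ax xb]; have := le_trans ax xb; rewrite leNgt ba.
have [c _ hc] := @EVT_max R (fun x => `|phi x|) a b ab
  (@continuous_subspaceT _ _ _ _ (fun x => continuous_comp (cphi x) (@norm_continuous _ _ _))).
by exists (`|phi c|) => // x /hc.
Qed.

Lemma FTC2_segment (phi Phi : R -> R) (a b : R) : a <= b -> continuous phi ->
  (forall x : R, is_derive x (1 : R) Phi (phi x)) ->
  (\int[mu]_(x in `[a, b]) phi x = Phi b - Phi a)%R.
Proof.
rewrite le_eqVlt => /predU1P[<- _ _|ab cphi dPhi].
  by rewrite set_itv1 Rintegral_set1 subrr.
rewrite /Rintegral (@continuous_FTC2 _ _ Phi)//.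
- exact: continuous_subspaceT.
- have cPhi : continuous Phi.
    by move=> x; apply: differentiable_continuous; apply/derivable1_diffP; have [] := dPhi x.
  split.
  + by move=> x _; have [] := dPhi x.
  + by apply: cvg_at_right_filter; exact: cPhi.
  + by apply: cvg_at_left_filter; exact: cPhi.
- by move=> x _; rewrite derive1E; have [_ ->] := dPhi x.
Qed.

(** Fubini for $g(t)\phi(x)$ on the triangle $0 \le t \le x \le b$: integrating over [t] first
    leaves the primitive of [g] times [phi], integrating over [x] first leaves $g(t)(\Phi(b) -
    \Phi(t))$. *)
Lemma Rintegration_by_parts_primitive (g phi Phi : R -> R) (b : R) : 0 <= b ->
  mu.-integrable `[0, b] (EFin \o g) -> continuous phi ->
  (forall x : R, is_derive x (1 : R) Phi (phi x)) ->
  (\int[mu]_(x in `[0, b]) (g x * Phi x) =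
   (\int[mu]_(x in `[0, b]) g x) * Phi b -
   \int[mu]_(x in `[0, b]) ((\int[mu]_(t in `[0, x]) g t) * phi x))%R.
Proof.
move=> b0 ig cphi dPhi.
have cPhi : continuous Phi.
  by move=> x; apply: differentiable_continuous; apply/derivable1_diffP; have [] := dPhi x.
pose D := `[0%R, b]%classic : set R.
have mD : measurable D by exact: measurable_itv.
have [M M0 hM] := @continuous_segment_bounded phi 0 b cphi.
have mg : measurable_fun D g by apply/measurable_EFinP; exact: measurable_int ig.
have mphi : measurable_fun setT phi by exact: continuous_measurable_fun.
(* Extension by zero, together with the indicator of $t \le x$ below, turns the triangle into an
   integrand on the whole plane. *)
pose gD := g \_ D; pose pD := phi \_ D.
have mgD : measurable_fun setT gD by apply/(measurable_restrictT _ _).1.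
have mpD : measurable_fun setT pD.
  by apply/(measurable_restrictT _ _).1 => //; exact: measurable_funS mphi.
pose A : set (R * R) := [set p | p.2 <= p.1].
have mA : measurable A.
  have := @measurable_fun_ler _ _ R setT (fun p : R * R => p.2) (fun p : R * R => p.1)
     measurable_snd measurable_fst.
  move=> /(_ measurableT [set true] I).
  by rewrite setTI; congr measurable; apply/seteqP; split => p //=.
pose f (p : R * R) : \bar R := (gD p.2 * pD p.1 * \1_A p)%:E.
have mf : measurable_fun setT f.
  apply/measurable_EFinP; apply: measurable_funM; last exact: measurable_indic.
  apply: measurable_funM.
    exact: (measurableT_comp mgD measurable_snd).
  exact: (measurableT_comp mpD measurable_fst).
have igD : mu.-integrable setT (EFin \o gD).
  by have := (@integrable_mkcond _ _ _ mu D (EFin \o g) mD).1 ig; rewrite restrict_EFin.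
pose K := (\int[mu]_t `|gD t|%:E)%E.
have K0 : (0 <= K)%E by apply: integral_ge0 => t _; rewrite lee_fin.
have Kfin : K \is a fin_num.
  by rewrite ge0_fin_numE//; have /integrableP[_] := igD.
(* The majorant is an integrable function of [x] times one of [t], so Tonelli gives integrability on
   the plane. *)
have fle (x t : R) : `|gD t * pD x * \1_A (x, t)| <= (cst M \_ D) x * `|gD t|.
  rewrite !normrM -mulrA mulrC; apply: ler_wpM2r => //.
  rewrite -[leRHS]mulr1; apply: ler_pM => //; last first.
    by rewrite indicE; case: (_ \in _); rewrite ?normr1 ?normr0.
  rewrite /pD !patchE; case: ifPn => [xD|_]; last by rewrite normr0.
  by apply: hM; move: xD; rewrite inE /D /= in_itv.
have iM : mu.-integrable setT (EFin \o (cst M \_ D)).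
  have := (@integrable_mkcond _ _ _ mu D (EFin \o cst M) mD).1; rewrite restrict_EFin.
  by apply; apply: continuous_segment_integrable; exact: cst_continuous.
have MD0 x : 0 <= (cst M \_ D) x.
  by rewrite patchE; case: ifPn.
have if_ : (mu \x mu)%E.-integrable setT f.
  apply/(integrable12ltyP mu mu mf).
  apply: (@le_lt_trans _ _ (\int[mu]_x ((cst M \_ D) x * fine K)%:E)%E); last first.
    apply: integrable_lty => //.
    exact: integrable_mulr.
  apply: ge0_le_integral => //.
  - by move=> x _; apply: integral_ge0.
  - have maf : measurable_fun setT (fun p : R * R => `|f p|%E) by exact: measurableT_comp.
    exact: (@measurable_fun_fubini_tonelli_F _ _ _ _ _ mu _ maf (fun=> abse_ge0 _)).
  - apply/measurable_EFinP; apply: measurable_funM => //.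
    by apply/(measurable_restrictT _ _).1.
  - move=> x _; rewrite EFinM fineK// /K -ge0_integralZl//; last 2 first.
      by apply/measurable_EFinP; exact: measurableT_comp.
      by rewrite lee_fin.
    apply: ge0_le_integral => //.
    + apply: measurableT_comp => //; exact: (measurableT_comp mf (pair1_measurable x)).
    + apply: measurable_funeM; apply/measurable_EFinP; exact: measurableT_comp.
    + by move=> t _; rewrite /f /= -EFinM lee_fin fle.
have EFinR (E : set R) (h : R -> R) : measurable E -> mu.-integrable E (EFin \o h) ->
    (\int[mu]_(x in E) (h x)%:E = (\int[mu]_(x in E) h x)%R%:E)%E.
  by move=> mE ih; rewrite /Rintegral fineK//; exact: integrable_fin_num.
have := Fubini if_.
have -> : (fun x => \int[mu]_t f (x, t))%E =
    (EFin \o (fun x => (\int[mu]_(t in `[0%R, x]) g t)%R * phi x)) \_ D.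
  apply/funext => x; rewrite patchE; case: ifPn => xD; last first.
    apply: integral0_eq => t _.
    by rewrite /f /= /pD patchE (negbTE xD) mulr0 mul0r.
  have /andP[x0 xb] : 0 <= x <= b by move: xD; rewrite inE /D /= in_itv.
  have igx : mu.-integrable `[0, x] (EFin \o g).
    by apply: integrableS ig => //; apply: subset_itvl; rewrite bnd_simp.
  rewrite /= -RintegralZr// -EFinR//; last first.
    exact: integrable_mulr.
  rewrite [RHS]integral_mkcond; apply: eq_integral => t _.
  rewrite /f /= /pD /gD !patchE xD indicE.
  have -> : ((x, t) \in A) = (t <= x) by apply/idP/idP; rewrite inE.
  have -> : (t \in D) = (0 <= t <= b).
    by apply/idP/idP; rewrite inE /D /= in_itv.
  have -> : (t \in `[0%R, x]%classic) = (0 <= t <= x).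
    by apply/idP/idP; rewrite inE /= in_itv.
  have [t0|] := leP 0 t; last by rewrite !mul0r.
  have [tx|] /= := leP t x; last by rewrite mulr0.
  by rewrite (le_trans tx xb) mulr1.
have -> : (fun t => \int[mu]_x f (x, t))%E =
    (EFin \o (fun t => g t * Phi b - g t * Phi t)) \_ D.
  apply/funext => t; rewrite patchE; case: ifPn => tD; last first.
    apply: integral0_eq => x _.
    by rewrite /f /= /gD patchE (negbTE tD) !mul0r.
  have /andP[t0 tb] : 0 <= t <= b by move: tD; rewrite inE /D /= in_itv.
  rewrite /= -mulrBr -(FTC2_segment tb cphi dPhi) -RintegralZl//; last first.
    exact: continuous_segment_integrable.
  rewrite -EFinR//; last first.
    apply: integrable_mull => //.
    exact: continuous_segment_integrable.
  rewrite [RHS]integral_mkcond; apply: eq_integral => x _.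
  rewrite /f /= /pD /gD !patchE tD indicE.
  have -> : ((x, t) \in A) = (t <= x) by apply/idP/idP; rewrite inE.
  have -> : (x \in D) = (0 <= x <= b).
    by apply/idP/idP; rewrite inE /D /= in_itv.
  have -> : (x \in `[t, b]%classic) = (t <= x <= b).
    by apply/idP/idP; rewrite inE /= in_itv.
  have [tx|] /= := leP t x; last by rewrite mulr0.
  rewrite (le_trans t0 tx) mulr1 /=.
  by case: (x <= b); rewrite ?mulr0.
rewrite -!integral_mkcond => /(congr1 fine).
rewrite -[LHS]/(Rintegral mu D _) -[RHS]/(Rintegral mu D _) => ->.
have igP : mu.-integrable D (EFin \o (fun t => g t * Phi t)).
  have [M' M'0 hM'] := @continuous_segment_bounded Phi 0 b cPhi.
  have igM : mu.-integrable D (EFin \o (fun t => M' * `|g t|)).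
    by apply: integrable_mull => //; exact: (integrable_norm ig).
  apply: le_integrable igM => //.
    apply/measurable_EFinP; apply: measurable_funM => //.
    by apply: measurable_funS (continuous_measurable_fun cPhi).
  move=> t Dt /=; rewrite lee_fin !normrM normr_id mulrC.
  apply: ler_wpM2r => //; apply: le_trans (ler_norm _).
  by apply: hM'; move: Dt; rewrite /D /= in_itv.
have igb : mu.-integrable D (EFin \o (fun t => g t * Phi b)).
  exact: integrable_mulr.
by rewrite RintegralB// RintegralZr// opprB addrC subrK.
Qed.
End integration_by_parts.

(** * Exponentials, their values at the endpoint, and primitives on $[0,\pi]$ *)

Section fourier_basics.
Variable R : realType.
Local Notation mu := (@lebesgue_measure R).
Local Notation Re := (@complex.Re R).
Local Notation Im := (@complex.Im R).
Local Notation D := (`[0%R, pi]%classic : set R).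
Implicit Types (f g Y : R -> R[i]) (k l : int) (s : seq int) (a : int -> R[i]).

Lemma measurable_0pi : measurable D. Proof. exact: measurable_itv. Qed.
Local Notation mD := measurable_0pi.

(* The conjugate exponential [e^{-ikx}]. *)
Definition emi (k : int) (x : R) : R[i] := cexpmi (k%:~R * x).

Lemma emiD k l x : emi (k + l) x = emi k x * emi l x.
Proof.
by apply: complex_ext; rewrite ReImE /emi /= intrD mulrDl ?cosD ?sinD; ring.
Qed.

Lemma emi0 x : emi 0 x = 1.
Proof. by apply: complex_ext; rewrite /emi /= mulr0z mul0r ?cos0 ?sin0 ?oppr0. Qed.

Lemma emiJ k x : cj (emi k x) = emi (- k) x.
Proof. by apply: complex_ext; rewrite /emi /= mulrNz mulNr ?cosN ?sinN. Qed.

Lemma csq_emi k x : csq (emi k x) = 1.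
Proof. by rewrite /csq /= sqrrN cos2Dsin2. Qed.

Lemma emi_neq0 k x : emi k x != 0.
Proof. by apply/eqP => /(congr1 (@csq R)); rewrite csq_emi csq0 => /eqP; rewrite oner_eq0. Qed.

Lemma emi_pi k : emi k pi = (-1) ^+ odd `|k|%N.
Proof.
have EN n : emi n%:Z pi = (-1) ^+ n.
  elim: n => [|n IHn]; first by rewrite emi0.
  rewrite -addn1 PoszD emiD IHn exprD; congr (_ * _).
  by apply: complex_ext; rewrite /emi /= mul1r ?cospi ?sinpi ?oppr0.
rewrite signr_odd; case: k => n; first exact: EN.
rewrite NegzE -emiJ EN /=.
by rewrite -signr_odd; case: odd; apply: complex_ext; rewrite /= ?oppr0.
Qed.

Lemma mem_Gamma plus k : (k \in Gamma plus) = (odd `|k| == ~~ plus).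
Proof.
have -> : (k \in Gamma plus) = (if plus then (2 %| k)%Z else ~~ (2 %| k)%Z).
  by apply/idP/idP; rewrite inE.
by rewrite dvdzE /= dvdn2; case: plus; case: odd.
Qed.

(** The link between index set and boundary condition: the exponentials with frequency in
    [Gamma plus] satisfy the condition themselves. *)
Lemma emi_pi_Gamma plus k : k \in Gamma plus -> emi k pi = bsign R plus.
Proof. by rewrite mem_Gamma emi_pi => /eqP ->; case: plus. Qed.

Lemma Gamma_subr plus k l : k \in Gamma plus -> l \in Gamma plus -> k - l \in Gamma true.
Proof.
have H (b : bool) (j : int) : (j \in Gamma b) = (if b then (2 %| j)%Z else ~~ (2 %| j)%Z).
  by apply/idP/idP; rewrite inE.
rewrite !H; case: plus => [k2 l2|k2 l2]; first by rewrite rpredB.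
lia.
Qed.

Lemma continuous_Re_emi k : continuous (fun x : R => Re (emi k x)).
Proof.
move=> x; apply: continuous_comp; last exact: continuous_cos.
by apply: continuousM; [exact: cst_continuous|].
Qed.

Lemma continuous_Im_emi k : continuous (fun x : R => Im (emi k x)).
Proof.
move=> x; apply: continuousN; apply: continuous_comp; last exact: continuous_sin.
by apply: continuousM; [exact: cst_continuous|].
Qed.

Lemma cmeas_emi k (A : set R) : measurable A -> cmeas A (emi k).
Proof.
move=> mA; split; apply: (@measurable_funS _ _ _ _ setT) => //.
  by apply: continuous_measurable_fun; exact: continuous_Re_emi.
by apply: continuous_measurable_fun; exact: continuous_Im_emi.
Qed.

Lemma L2on_cst (z : R[i]) : L2on D (fun=> z).
Proof.
apply: (L2on_le mD (b := fun=> csq z)); [exact: cmeas_cst| |by []].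
by apply: continuous_segment_integrable; exact: cst_continuous.
Qed.

Lemma L2on_emi k : L2on D (emi k).
Proof.
apply: (L2on_le mD (b := fun=> 1)) => [||x _]; first exact: cmeas_emi mD.
  by apply: continuous_segment_integrable; exact: cst_continuous.
by rewrite csq_emi.
Qed.

Lemma L2on_L1on f : L2on D f -> L1on D f.
Proof. 
move=> If; have -> : f = (fun x => f x * 1) by apply/funext => x; rewrite mulr1.
exact: (L1on_ML2 mD If (L2on_cst 1)). Qed.

Lemma L2on_Memi f k : L2on D f -> L2on D (fun x => f x * emi k x).
Proof.
by move=> If; apply: (L2on_Mbounded mD (M := 1) If (cmeas_emi k mD)) => x _; rewrite csq_emi.
Qed.

Lemma L1on_Memi f k : L1on D f -> L1on D (fun x => f x * emi k x).
Proof.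
move=> If; have [f1 f2] := If.
apply: (@L1on_le _ _ mD (fun x => `|Re (f x)| + `|Im (f x)|)).
- by apply: cmeasM; [exact: L1on_cmeas|exact: cmeas_emi mD].
- have -> : EFin \o (fun x => `|Re (f x)| + `|Im (f x)|) =
     (fun x => `|Re (f x)|%:E + `|Im (f x)|%:E)%E by [].
  by apply: integrableD => //; [exact: (integrable_norm f1)|exact: (integrable_norm f2)].
- move=> x _; rewrite !ReImE /emi /=; split.
    rewrite mulrN opprK; apply: le_trans (ler_normD _ _) _.
    by rewrite !normrM; apply: lerD; rewrite ler_piMr// ?cos_max ?sin_max.
  apply: le_trans (ler_normD _ _) _.
  by rewrite !normrM normrN; apply: lerD; rewrite ler_piMr// ?cos_max ?sin_max.
Qed.

Lemma primitive_within_continuous (g : R -> R) (c : R) : mu.-integrable D (fun x => (g x)%:E) ->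
  {within D, continuous (fun x => c + \int[mu]_(t in `[0%R, x]) g t)}.
Proof.
move=> ig; have h := parameterized_integral_continuous (@pi_ge0 R) ig.
by move=> x; apply: cvgD; [exact: cvg_cst|exact: h].
Qed.

Lemma within_continuous_bounded (h : R -> R) : {within D, continuous h} ->
  exists M, forall x, D x -> `|h x| <= M.
Proof.
move=> ch.
have [c _ hc] := @EVT_max R h 0 pi (@pi_ge0 R) ch.
have [d _ hd] := @EVT_min R h 0 pi (@pi_ge0 R) ch.
exists (`|h c| + `|h d|) => x Dx.
have := hc x Dx; have := hd x Dx.
have := ler_norm (h c); have := ler_norm (- h d); rewrite normrN.
have := normr_ge0 (h c); have := normr_ge0 (h d).
by rewrite ler_norml; lra.
Qed.

Lemma primitive_ReE Y g x : primitive_on Y g -> D x ->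
  Re (Y x) = Re (Y 0) + \int[mu]_(t in `[0%R, x]) Re (g t).
Proof. by move=> Yg; rewrite /= in_itv /= => /Yg ->; rewrite cReD. Qed.

Lemma primitive_ImE Y g x : primitive_on Y g -> D x ->
  Im (Y x) = Im (Y 0) + \int[mu]_(t in `[0%R, x]) Im (g t).
Proof. by move=> Yg; rewrite /= in_itv /= => /Yg ->; rewrite cImD. Qed.

(** [primitive_on] constrains [Y] on $[0,\pi]$ only, so measurability is transferred there from the
    continuous indefinite integral. *)
Lemma primitive_cmeas Y g : L1on D g -> primitive_on Y g -> cmeas D Y.
Proof.
move=> [g1 g2] Yg.
have c1 := primitive_within_continuous g1 (c := Re (Y 0)).
have c2 := primitive_within_continuous g2 (c := Im (Y 0)).
split.
- refine (@eq_measurable_fun _ _ _ _ D (fun x => Re (Y 0) + \int[mu]_(t in `[0%R, x]) Re (g t)) _ _ _).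
    by move=> x /set_mem Dx; rewrite (primitive_ReE Yg Dx).
  exact: (subspace_continuous_measurable_fun mD c1).
- refine (@eq_measurable_fun _ _ _ _ D (fun x => Im (Y 0) + \int[mu]_(t in `[0%R, x]) Im (g t)) _ _ _).
    by move=> x /set_mem Dx; rewrite (primitive_ImE Yg Dx).
  exact: (subspace_continuous_measurable_fun mD c2).
Qed.

Lemma primitive_bounded Y g : L1on D g -> primitive_on Y g ->
  exists2 M, 0 <= M & forall x, D x -> `|Re (Y x)| <= M /\ `|Im (Y x)| <= M.
Proof.
move=> [g1 g2] Yg.
have [M1 h1] := within_continuous_bounded (primitive_within_continuous g1 (c := Re (Y 0))).
have [M2 h2] := within_continuous_bounded (primitive_within_continuous g2 (c := Im (Y 0))).
exists (`|M1| + `|M2|) => [|x Dx]; first by rewrite addr_ge0.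
rewrite (primitive_ReE Yg Dx) (primitive_ImE Yg Dx); split.
  by apply: le_trans (h1 _ Dx) _; apply: le_trans (ler_norm _) _; rewrite lerDl.
by apply: le_trans (h2 _ Dx) _; apply: le_trans (ler_norm _) _; rewrite lerDr.
Qed.

Lemma bounded_L2on f (M : R) : cmeas D f ->
  (forall x, D x -> `|Re (f x)| <= M /\ `|Im (f x)| <= M) -> L2on D f.
Proof.
move=> mf fM; apply: (L2on_le mD (b := fun=> M ^+ 2 + M ^+ 2)) => //.
  by apply: continuous_segment_integrable; exact: cst_continuous.
move=> x /fM[h1 h2]; apply: lerD; rewrite -real_normK ?num_real// ler_sqr ?nnegrE//.
  exact: le_trans h1.
exact: le_trans h2.
Qed.

Lemma primitive_L2on Y g : L1on D g -> primitive_on Y g -> L2on D Y.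
Proof.
move=> Ig Yg; have [M _ hM] := primitive_bounded Ig Yg.
exact: bounded_L2on (primitive_cmeas Ig Yg) hM.
Qed.

Lemma is_derive_cosM (c x : R) : is_derive x 1 (fun x => cos (c * x)) (- (c * sin (c * x))).
Proof. by apply: is_derive_eq; rewrite /GRing.scale /=; ring. Qed.

Lemma is_derive_sinM (c x : R) : is_derive x 1 (fun x => sin (c * x)) (c * cos (c * x)).
Proof. by apply: is_derive_eq; rewrite /GRing.scale /=; ring. Qed.

End fourier_basics.

(** * Integration by parts against the exponentials *)

Section fourier_bessel.
Variable R : realType.
Local Notation mu := (@lebesgue_measure R).
Local Notation Re := (@complex.Re R).
Local Notation Im := (@complex.Im R).
Local Notation D := (`[0%R, pi]%classic : set R).
Local Notation mD := (@measurable_0pi R).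
Local Notation emi := (@emi R).
Implicit Types (f g Y : R -> R[i]) (k l : int) (s : seq int) (a : int -> R[i]).

Lemma eq_primitive_on Y g : primitive_on Y g -> {in D, Y =1 (fun x => Y 0 + cint `[0%R, x] g)}.
Proof. by move=> Yg x /set_mem; rewrite /= in_itv /= => /Yg. Qed.

Lemma cint_set1 f (x : R) : cint [set x] f = 0.
Proof. by apply: complex_ext; rewrite /= Rintegral_set1. Qed.

Lemma primitive_cint g : primitive_on (fun x => cint `[0%R, x] g) g.
Proof. by move=> x _; rewrite set_itv1 cint_set1 add0r. Qed.

Lemma by_parts_real (g : R -> R) (phi Phi : R -> R) :
  mu.-integrable D (fun x => (g x)%:E) -> continuous phi ->
  (forall x : R, is_derive x (1 : R) Phi (phi x)) ->
  \int[mu]_(x in D) (g x * Phi x) = (\int[mu]_(x in D) g x) * Phi pi -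
   \int[mu]_(x in D) ((\int[mu]_(t in `[0%R, x]) g t) * phi x).
Proof. by move=> ig cphi dPhi; exact: Rintegration_by_parts_primitive (@pi_ge0 R) ig cphi dPhi. Qed.

(** The primitive vanishes at 0, which leaves a single boundary term, at [pi]. The complex identity
    is assembled from four real ones, for the two parts of [g] against cosine and sine. *)
Lemma cint_by_parts0 g k : L1on D g ->
  cint D (fun x => g x * emi k x) = cint D g * emi k pi +
  'i * (k%:~R)%:C * cint D (fun x => cint `[0%R, x] g * emi k x).
Proof.
move=> Ig; have [g1 g2] := Ig.
pose G x : R[i] := cint `[0%R, x] g.
have GP : primitive_on G g := primitive_cint g.
have IG : L2on D G by exact: primitive_L2on Ig GP.
have [G1 G2] := L2on_L1on IG.
set c : R := k%:~R.
have cc : continuous (fun x : R => c * cos (c * x)).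
  by move=> x; apply: cvgM; [exact: cvg_cst|exact: continuous_Re_emi].
have cs : continuous (fun x : R => - (c * sin (c * x))).
  move=> x; apply: cvgN; apply: cvgM; first exact: cvg_cst.
  by apply: continuous_comp; [apply: continuousM; [exact: cst_continuous|]|exact: continuous_sin].
have Iu (u v : R -> R) M : mu.-integrable D (EFin \o u) -> continuous v ->
    (forall x, `|v x| <= M) -> mu.-integrable D (EFin \o (fun x => u x * v x)).
  move=> iu cv vM; have iM := integrable_mulr M mD (integrable_norm iu).
  apply: le_integrable iM => //.
    apply/measurable_EFinP; apply: measurable_funM.
      by apply/measurable_EFinP; exact: measurable_int iu.
    by apply: measurable_funS (continuous_measurable_fun cv).
  move=> x Dx /=; rewrite lee_fin !normrM normr_id; apply: ler_wpM2l => //.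
  exact: le_trans (vM x) (ler_norm _).
have ccM x : `|c * cos (c * x)| <= `|c| by rewrite normrM ler_piMr// cos_max.
have csM x : `|- (c * sin (c * x))| <= `|c| by rewrite normrN normrM ler_piMr// sin_max.
have c0 : continuous (fun x : R => cos (c * x)) by exact: continuous_Re_emi.
have s0 : continuous (fun x : R => sin (c * x)).
  by move=> x; apply: continuous_comp; [apply: continuousM; [exact: cst_continuous|]|exact: continuous_sin].
have cM x : `|cos (c * x)| <= 1 by exact: cos_max.
have sM x : `|sin (c * x)| <= 1 by exact: sin_max.
have B1 := by_parts_real g1 cs (is_derive_cosM c).
have B2 := by_parts_real g2 cs (is_derive_cosM c).
have B3 := by_parts_real g1 cc (is_derive_sinM c).
have B4 := by_parts_real g2 cc (is_derive_sinM c).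
have i1 := Iu _ _ _ g1 c0 cM. have i2 := Iu _ _ _ g2 c0 cM.
have i3 := Iu _ _ _ g1 s0 sM. have i4 := Iu _ _ _ g2 s0 sM.
have j1 := Iu _ _ _ G1 c0 cM. have j2 := Iu _ _ _ G2 c0 cM.
have j3 := Iu _ _ _ G1 s0 sM. have j4 := Iu _ _ _ G2 s0 sM.
have Zs (u : R -> R) : mu.-integrable D (EFin \o (fun x => u x * sin (c * x))) ->
    \int[mu]_(x in D) (u x * (- (c * sin (c * x)))) = - c * \int[mu]_(x in D) (u x * sin (c * x)).
  by move=> iu; rewrite -RintegralZl//; apply: eq_Rintegral => x _; ring.
have Zc (u : R -> R) : mu.-integrable D (EFin \o (fun x => u x * cos (c * x))) ->
    \int[mu]_(x in D) (u x * (c * cos (c * x))) = c * \int[mu]_(x in D) (u x * cos (c * x)).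
  by move=> iu; rewrite -RintegralZl//; apply: eq_Rintegral => x _; ring.
have ReF f : mu.-integrable D (EFin \o (fun x => Re (f x) * cos (c * x))) ->
    mu.-integrable D (EFin \o (fun x => Im (f x) * sin (c * x))) ->
    Re (cint D (fun x => f x * emi k x)) =
    \int[mu]_(x in D) (Re (f x) * cos (c * x)) + \int[mu]_(x in D) (Im (f x) * sin (c * x)).
  by move=> h1 h2; rewrite -RintegralD//; apply: eq_Rintegral => x _; rewrite cReM /=; ring.
have ImF f : mu.-integrable D (EFin \o (fun x => Im (f x) * cos (c * x))) ->
    mu.-integrable D (EFin \o (fun x => Re (f x) * sin (c * x))) ->
    Im (cint D (fun x => f x * emi k x)) =
    \int[mu]_(x in D) (Im (f x) * cos (c * x)) - \int[mu]_(x in D) (Re (f x) * sin (c * x)).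
  by move=> h1 h2; rewrite -RintegralB//; apply: eq_Rintegral => x _; rewrite cImM /=; ring.
rewrite (Zs (fun x => Re (G x)))// in B1.
rewrite (Zs (fun x => Im (G x)))// in B2.
rewrite (Zc (fun x => Re (G x)))// in B3.
rewrite (Zc (fun x => Im (G x)))// in B4.
apply: complex_ext.
  rewrite ReF// cReD !cReM !cImM ReF// ImF// B1 B4 /=; ring.
rewrite ImF// cImD !cImM !cReM ReF// ImF// B2 B3 /=; ring.
Qed.

(** The by-parts formula for the constant function 1 with derivative 0. It is not divided by [k],
    hence covers [k = 0], and serves to add a constant to a primitive. *)
Lemma cint1_emi k : 0 = emi k pi - 1 + 'i * (k%:~R)%:C * cint D (emi k).
Proof.
set c : R := k%:~R.
have cc : continuous (fun x : R => c * cos (c * x)).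
  by move=> x; apply: cvgM; [exact: cvg_cst|exact: continuous_Re_emi].
have cs : continuous (fun x : R => - (c * sin (c * x))).
  move=> x; apply: cvgN; apply: cvgM; first exact: cvg_cst.
  by apply: continuous_comp; [apply: continuousM; [exact: cst_continuous|]|exact: continuous_sin].
have h1 := FTC2_segment (@pi_ge0 R) cs (is_derive_cosM c).
have h2 := FTC2_segment (@pi_ge0 R) cc (is_derive_sinM c).
have [e1 e2] := L2on_L1on (@L2on_emi R k).
have hr : c * Im (cint D (emi k)) = cos (c * pi) - 1.
  by rewrite -cos0 -[in RHS](mulr0 c) -h1 -RintegralZl//; apply: eq_Rintegral => x _ /=; ring.
have hi : c * Re (cint D (emi k)) = sin (c * pi).
  by rewrite -[RHS]subr0 -[in RHS]sin0 -[in RHS](mulr0 c) -h2 -RintegralZl//.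
move: (cint D (emi k)) hr hi => I hr hi.
apply: complex_ext; rewrite !ReImE /= -/c.
  lra.
lra.
Qed.

Lemma cint_by_parts Y g k : L1on D g -> primitive_on Y g ->
  cint D (fun x => g x * emi k x) = Y pi * emi k pi - Y 0 +
  'i * (k%:~R)%:C * cint D (fun x => Y x * emi k x).
Proof.
move=> Ig Yg; rewrite cint_by_parts0//.
have Ypi : Y pi = Y 0 + cint D g by rewrite [LHS]Yg// pi_ge0 lexx.
pose G x : R[i] := cint `[0%R, x] g.
have GP : primitive_on G g := primitive_cint g.
have IG : L2on D G by exact: primitive_L2on Ig GP.
rewrite (@eq_cint _ D (fun x => Y x * emi k x) (fun x => Y 0 * emi k x + G x * emi k x)); last first.
  by move=> x /(eq_primitive_on Yg) ->; rewrite mulrDl.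
have IE := L2on_L1on (@L2on_emi R k).
rewrite (cintD mD (L1onZ mD _ IE) (L1on_Memi k (L2on_L1on IG))) (cintZ mD _ IE) Ypi.
have := @cint1_emi k => h.
(* The inserted zero is expanded with [cint1_emi] and supplies the terms that come from the constant
   [Y 0]. *)
rewrite -/G; transitivity (cint D g * emi k pi + 'i * k%:~R%:C * cint D (fun x => G x * emi k x) + Y 0 * 0).
  by rewrite mulr0 addr0.
rewrite h; ring.
Qed.

End fourier_bessel.

(** * Orthogonality, trigonometric polynomials and Bessel's inequality *)

Section fourier_coefficients.
Variable R : realType.
Local Notation mu := (@lebesgue_measure R).
Local Notation Re := (@complex.Re R).
Local Notation Im := (@complex.Im R).
Local Notation D := (`[0%R, pi]%classic : set R).
Local Notation mD := (@measurable_0pi R).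
Local Notation emi := (@emi R).
Implicit Types (f g Y : R -> R[i]) (k l : int) (s : seq int) (a : int -> R[i]) (b : bool).

Lemma realC_neq0 (x : R) : x != 0 -> (x%:C : R[i]) != 0.
Proof. by apply: contra => /eqP[->]. Qed.

Lemma pi_neq0 : (pi : R) != 0. Proof. by rewrite gt_eqF ?pi_gt0. Qed.

Lemma piVK : (pi : R)%:C * (pi^-1)%:C = 1.
Proof. by apply: complex_ext; rewrite !ReImE /= ?mulfV ?pi_neq0//; ring. Qed.

Lemma cint_fourier f k : cint D (fun x => f x * emi k x) = (pi : R)%:C * fourier f k.
Proof. by rewrite /fourier mulrA piVK mul1r. Qed.

Lemma fourierD f g k : L1on D f -> L1on D g ->
  fourier (fun x => f x + g x) k = fourier f k + fourier g k.
Proof.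
move=> If Ig; rewrite /fourier -mulrDr -(cintD mD (L1on_Memi k If) (L1on_Memi k Ig)).
by congr (_ * _); apply: eq_cint => x _; rewrite mulrDl.
Qed.

Lemma fourierZ (z : R[i]) f k : L1on D f ->
  fourier (fun x => z * f x) k = z * fourier f k.
Proof.
move=> If; rewrite /fourier mulrCA -(cintZ mD _ (L1on_Memi k If)).
by congr (_ * _); apply: eq_cint => x _; rewrite mulrA.
Qed.

Lemma eq_fourier f g k : {in D, f =1 g} -> fourier f k = fourier g k.
Proof. by move=> fg; congr (_ * _); apply: eq_cint => x /fg ->. Qed.

Lemma fourierN f k : L1on D f -> fourier (fun x => - f x) k = - fourier f k.
Proof.
move=> If; rewrite -mulN1r -fourierZ//.
by apply: eq_fourier => x _; rewrite mulN1r.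
Qed.

Lemma fourierB f g k : L1on D f -> L1on D g ->
  fourier (fun x => f x - g x) k = fourier f k - fourier g k.
Proof. by move=> If Ig; rewrite fourierD ?fourierN//; exact: (L1onN mD). Qed.

Lemma ae_eq_fourier f g k : cmeas D f -> cmeas D g ->
  {ae mu, forall x, D x -> f x = g x} -> fourier f k = fourier g k.
Proof.
move=> mf mg fg; congr (_ * _); apply: (ae_eq_cint mD).
- by apply: cmeasM => //; exact: cmeas_emi mD.
- by apply: cmeasM => //; exact: cmeas_emi mD.
- by apply: lebesgue_aeS fg => x /[apply] ->.
Qed.

Lemma fourier_Memi f k l : fourier (fun x => f x * emi l x) k = fourier f (k + l).
Proof.
by congr (_ * _); apply: eq_cint => x _;
  rewrite -/(emi k x) -/(emi (k + l) x) emiD; ring.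
Qed.

(** On an interval of length pi only the even exponentials are periodic. Two frequencies of the same
    [Gamma] differ by an even number, so this case suffices for orthogonality. *)
Lemma cint_emi k : k \in Gamma true -> cint D (emi k) = if k == 0 then (pi : R)%:C else 0.
Proof.
move=> kG; case: eqVneq => [->|k0].
  apply: complex_ext.
    transitivity (\int[mu]_(x in D) (1 : R)).
      by apply: eq_Rintegral => x _; rewrite emi0.
    have := FTC2_segment (@pi_ge0 R) (@cst_continuous _ _ (1 : R)) (fun x : R => is_derive_id x (1 : R)).
    by rewrite subr0.
  transitivity (\int[mu]_(x in D) (0 : R)).
    by apply: eq_Rintegral => x _; rewrite emi0.
  by rewrite Rintegral_cst// mul0r.
have := @cint1_emi R k; rewrite (emi_pi_Gamma R kG) subrr add0r => /esym/eqP.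
rewrite !mulf_eq0 => /orP[/orP[/eqP/(congr1 Im)/= /eqP|/eqP/(congr1 Re)/= /eqP]|/eqP//].
  by rewrite oner_eq0.
by rewrite intr_eq0 (negbTE k0).
Qed.

Lemma fourier_emi b k l : k \in Gamma b -> l \in Gamma b ->
  fourier (emi (- l)) k = (k == l)%:R.
Proof.
move=> kG lG; rewrite /fourier.
rewrite (@eq_cint _ _ _ (emi (k - l))); last by move=> x _; rewrite emiD mulrC.
rewrite cint_emi ?(Gamma_subr kG lG)// subr_eq0; case: eqP => _; last by rewrite mulr0.
by rewrite mulrC piVK.
Qed.

Lemma csqB (z w : R[i]) : csq (z - w) = csq z + csq w - 2 * Re (cj w * z).
Proof. rewrite /csq !ReImE; ring. Qed.

(** The trigonometric polynomial with coefficients [a]; as [emi] is the conjugate exponential,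
    $e^{ikx}$ is [emi (- k) x]. *)
Definition trig a s (x : R) : R[i] := \sum_(k <- s) a k * emi (- k) x.

Lemma L2on_sum I (r : seq I) (F : I -> R -> R[i]) :
  (forall i, L2on D (F i)) -> L2on D (fun x => \sum_(i <- r) F i x).
Proof.
move=> iF; elim: r => [|i r IHr].
  have -> : (fun x => \sum_(i <- [::]) F i x) = (fun=> 0).
    by apply/funext => x; rewrite big_nil.
  exact: L2on_cst.
have -> : (fun x => \sum_(j <- i :: r) F j x) = (fun x => F i x + \sum_(j <- r) F j x).
  by apply/funext => x; rewrite big_cons.
exact: (L2onD mD).
Qed.

Lemma L2on_trig a s : L2on D (trig a s).
Proof. by apply: L2on_sum => k; apply: (L2onZ mD); exact: L2on_emi. Qed.

Lemma cint_mul_trig f a s : L2on D f ->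
  cint D (fun x => f x * trig a s x) = (pi : R)%:C * \sum_(k <- s) a k * fourier f (- k).
Proof.
move=> If; rewrite mulr_sumr.
rewrite (@eq_cint _ _ _ (fun x => \sum_(k <- s) a k * (f x * emi (- k) x))); last first.
  by move=> x _; rewrite mulr_sumr; apply: eq_bigr => k _; rewrite mulrCA.
rewrite (cint_sum mD); last by move=> k; apply: (L1onZ mD); exact/L2on_L1on/L2on_Memi.
apply: eq_bigr => k _; rewrite (cintZ mD); last exact/L2on_L1on/L2on_Memi.
by rewrite cint_fourier; ring.
Qed.

Lemma cj_sum I (r : seq I) (F : I -> R[i]) : cj (\sum_(i <- r) F i) = \sum_(i <- r) cj (F i).
Proof.
by apply: (big_morph (@cj R)) => [x y|]; [exact: conjD|apply: complex_ext; rewrite /= ?oppr0].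
Qed.

(** The conjugate of a trigonometric polynomial is again one, with reflected frequencies and
    conjugate coefficients, so the bilinear formula applies. *)
Lemma cint_mul_cj_trig f a s : L2on D f ->
  cint D (fun x => f x * cj (trig a s x)) = (pi : R)%:C * \sum_(k <- s) cj (a k) * fourier f k.
Proof.
move=> If.
have -> : (fun x => f x * cj (trig a s x)) =
    (fun x => f x * trig (fun k => cj (a (- k))) (map -%R s) x).
  apply/funext => x; congr (_ * _); rewrite /trig cj_sum big_map.
  by apply: eq_bigr => k _; rewrite conjM emiJ !opprK.
by rewrite cint_mul_trig// big_map; congr (_ * _); apply: eq_bigr => k _; rewrite !opprK.
Qed.

Lemma fourier_trig b a s k : uniq s -> all (mem (Gamma b)) s -> k \in Gamma b ->
  fourier (trig a s) k = if k \in s then a k else 0.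
Proof.
move=> us sG kG.
have -> : fourier (trig a s) k = \sum_(l <- s) a l * fourier (emi (- l)) k.
  rewrite /fourier (@eq_cint _ _ _ (fun x => \sum_(l <- s) a l * (emi (- l) x * emi k x))); last first.
    by move=> x _; rewrite mulr_suml; apply: eq_bigr => l _; rewrite mulrA.
  have IEE l : L1on D (fun x => emi (- l) x * emi k x) by exact/L2on_L1on/L2on_Memi/L2on_emi.
  rewrite (cint_sum mD); last by move=> l; exact: (L1onZ mD).
  by rewrite mulr_sumr; apply: eq_bigr => l _; rewrite (cintZ mD)//; ring.
rewrite big_seq.
rewrite (eq_bigr (fun l => if l == k then a k else 0)); last first.
  move=> l ls; have lG : l \in Gamma b := allP sG _ ls.
  rewrite (fourier_emi kG lG) eq_sym.
  by case: eqP => [->|_]; rewrite ?mulr1 ?mulr0.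
rewrite -big_seq; case: ifPn => ks.
  by rewrite (bigD1_seq k)//= eqxx big1 ?addr0// => l /negbTE ->.
by rewrite big_seq big1// => l ls; case: eqP ls ks => // -> ->.
Qed.

Local Notation norm2 := (norm2 D).

Lemma norm2_trig b a s : uniq s -> all (mem (Gamma b)) s ->
  norm2 (trig a s) = pi * \sum_(k <- s) csq (a k).
Proof.
move=> us sG; rewrite norm2E.
rewrite cint_mul_cj_trig; last exact: L2on_trig.
rewrite cReM /= mul0r subr0 Re_sum; congr (_ * _).
rewrite big_seq [RHS]big_seq; apply: eq_bigr => k ks.
have kG : k \in Gamma b := allP sG _ ks.
by rewrite (fourier_trig _ us sG kG) ks mulrC -csq_conj.
Qed.

(** Expanding the square and completing it in each [a k]. The choice [a = fourier f] gives Bessel's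
    inequality and the exact error of the partial sums; a polynomial [f] gives the norm of a block
    of frequencies. *)
Lemma norm2_sub_trig b f a s : uniq s -> all (mem (Gamma b)) s -> L2on D f ->
  norm2 (fun x => f x - trig a s x) =
  norm2 f - pi * \sum_(k <- s) csq (fourier f k) + pi * \sum_(k <- s) csq (fourier f k - a k).
Proof.
move=> us sG If; have IT := L2on_trig a s.
rewrite (norm2D mD If (L2onN mD IT)).
have -> : norm2 (fun x => - trig a s x) = pi * \sum_(k <- s) csq (a k).
  by rewrite -(norm2_trig a us sG); apply: eq_Rintegral => x _; rewrite csqN.
have -> : Re (cint D (fun x => f x * cj (- trig a s x))) =
    - (pi * \sum_(k <- s) Re (cj (a k) * fourier f k)).
  rewrite (@eq_cint _ _ _ (fun x => - (f x * cj (trig a s x)))); last first.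
    by move=> x _; apply: complex_ext; rewrite !ReImE; ring.
  rewrite (cintN mD (L1on_ML2 mD If (L2onJ mD IT))) cReN cint_mul_cj_trig//.
  by rewrite cReM /= mul0r subr0 Re_sum.
have -> : \sum_(k <- s) csq (fourier f k - a k) = \sum_(k <- s) csq (fourier f k) +
    \sum_(k <- s) csq (a k) - 2 * \sum_(k <- s) Re (cj (a k) * fourier f k).
  rewrite (eq_bigr _ (fun k _ => csqB (fourier f k) (a k))) sumrB.
  by rewrite big_split mulr_sumr.
ring.
Qed.

Lemma bessel b f s : uniq s -> all (mem (Gamma b)) s -> L2on D f ->
  pi * \sum_(k <- s) csq (fourier f k) <= norm2 f.
Proof.
move=> us sG If; have := norm2_ge0 D (fun x => f x - trig (fourier f) s x).
rewrite (norm2_sub_trig _ us sG If) [X in _ + _ * X]big1 ?mulr0 ?addr0 ?subr_ge0// => k _.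
by rewrite subrr csq0.
Qed.

(** Indexed as in [symsum], so that the partial sums behind [zseries] become sums over this list. *)
Definition srange b (N : nat) : seq int :=
  [seq k <- [seq j%:Z - N%:Z | j <- iota 0 (2 * N).+1] | k \in Gamma b].

Lemma srange_uniq b N : uniq (srange b N).
Proof.
apply: filter_uniq; rewrite map_inj_in_uniq ?iota_uniq// => i j _ _ /addIr.
by move=> [].
Qed.

Lemma srange_Gamma b N : all (mem (Gamma b)) (srange b N).
Proof. exact: filter_all. Qed.

Lemma mem_srange b N k : (k \in srange b N) = (k \in Gamma b) && (`|k| <= N)%N.
Proof.
rewrite mem_filter; congr (_ && _); apply/mapP/idP.
  by move=> [j]; rewrite mem_iota => /andP[_ jN] ->; lia.
move=> kN; exists (absz (k + N%:Z)); last by lia.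
by rewrite mem_iota; lia.
Qed.

Lemma symsum_srange b a N : (forall k, k \notin Gamma b -> a k = 0) ->
  symsum a N = \sum_(k <- srange b N) a k.
Proof.
move=> a0; rewrite /symsum /srange big_filter big_map /index_iota subn0.
rewrite [RHS]big_mkcond; apply: eq_bigr => j _.
by case: ifPn => // /a0.
Qed.

Lemma srange_sub b (N M : nat) : (N <= M)%N -> {subset srange b N <= srange b M}.
Proof. by move=> NM k; rewrite !mem_srange => /andP[-> /leq_trans]; apply. Qed.

End fourier_coefficients.

(** * Almost everywhere limits and the bounds that pass to them *)

Section riesz_fischer.
Variable R : realType.
Local Notation mu := (@lebesgue_measure R).
Local Notation Re := (@complex.Re R).
Local Notation Im := (@complex.Im R).
Local Notation D := (`[0%R, pi]%classic : set R).
Local Notation mD := (@measurable_0pi R).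
Local Notation emi := (@emi R).
Local Notation norm2 := (norm2 D).
Implicit Types (f g : R -> R[i]) (k : int) (a : int -> R[i]) (b : bool).

Lemma cvg_series_fin (u : nat -> R) : (\sum_(0 <= n <oo) `|u n|%:E < +oo)%E -> cvgn (series u).
Proof.
move=> ufin; apply: normed_cvg; apply: nondecreasing_is_cvgn.
  by apply: nondecreasing_series => n _ _; exact: normr_ge0.
exists (fine (\sum_(0 <= n <oo) `|u n|%:E)%E) => _ [n _ <-].
rewrite -lee_fin fineK; last first.
  by rewrite ge0_fin_numE//; apply: nneseries_ge0 => j _ _; rewrite lee_fin.
rewrite /= /series /= -sumEFin; apply: nneseries_lim_ge => j _ _.
by rewrite lee_fin.
Qed.

(** The sum of the absolute values has finite integral, hence is finite almost everywhere, and there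
    the series converges absolutely. *)
Lemma series_ae_cvg (p : nat -> R -> R) :
  (forall n, measurable_fun D (p n)) ->
  (\sum_(0 <= n <oo) \int[mu]_(x in D) `|p n x|%:E < +oo)%E ->
  exists2 g : R -> R, measurable_fun D g &
    {ae mu, forall x, D x -> (fun n => series (p^~ x) n) @ \oo --> g x}.
Proof.
move=> mp pfin.
pose h (x : R) := (\sum_(0 <= n <oo) `|p n x|%:E)%E.
have mpn n : measurable_fun D (fun x => `|p n x|%:E).
  by apply/measurable_EFinP; exact: measurableT_comp.
have h0 x : (0 <= h x)%E by apply: nneseries_ge0 => n _ _; rewrite lee_fin.
have ih : mu.-integrable D h.
  apply/integrableP; split.
    by apply: ge0_emeasurable_sum => [n x Dx _|n _]; [rewrite lee_fin|exact: mpn].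
  rewrite (_ : (\int[mu]_(x in D) `|h x|)%E = (\int[mu]_(x in D) h x)%E); last first.
    by apply: eq_integral => x _; rewrite gee0_abs.
  by rewrite integral_nneseries// => n x _; rewrite lee_fin.
(* The upper limit is measurable whether or not the series converges, and it agrees with the sum
   wherever the latter exists. *)
exists (fun x => fine (limn_esup (fun n => (series (p^~ x) n)%:E))).
  apply: (measurableT_comp (fine_measurable measurableT)).
  apply: measurable_fun_limn_esup => n; apply/measurable_EFinP.
  exact: (@measurable_sum _ _ _ D _ (index_iota 0 n) p mp).
have hae : {ae mu, forall x, D x -> h x \is a fin_num} := @integrable_ae _ _ _ mu D mD h ih.
apply: lebesgue_aeS hae => x /[apply] hfin.
have cs : cvgn (series (p^~ x)).
  by apply: cvg_series_fin; rewrite -ge0_fin_numE//; exact: h0.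
have /cvg_ex[l hl] := cs.
have hl' : (fun n => (series (p^~ x) n)%:E) @ \oo --> l%:E by apply: cvg_EFin hl; near=> n.
by rewrite is_cvg_limn_esupE ?(cvg_lim _ hl')//; apply/cvg_ex; exists l%:E.
Unshelve. all: by end_near. Qed.

Lemma limn_einf_le (u : nat -> \bar R) (c : \bar R) : (forall n, u n <= c)%E -> (limn_einf u <= c)%E.
Proof.
move=> uc; rewrite limn_einf_lim; apply: lime_le; first exact: is_cvg_einfs.
apply: nearW => n; apply: le_trans (uc n).
by apply: ereal_inf_lbound; exists n => //=.
Qed.

(** Fatou's lemma for [csq (F n x)], whose lower limit is [csq (g x)] at almost every point. *)
Lemma fatou_norm2 (F : nat -> R -> R[i]) g (c : R) :
  (forall n, L2on D (F n)) -> (forall n, norm2 (F n) <= c) -> cmeas D g ->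
  {ae mu, forall x, D x -> Re (F n x) @[n --> \oo] --> Re (g x) /\
                          Im (F n x) @[n --> \oo] --> Im (g x)} ->
  L2on D g /\ norm2 g <= c.
Proof.
move=> IF Fc mg cF.
have mF n : measurable_fun D (fun x => (csq (F n x))%:E).
  by apply/measurable_EFinP; apply: measurable_csq; have [] := IF n.
have mg2 : measurable_fun D (fun x => (csq (g x))%:E).
  by apply/measurable_EFinP; exact: measurable_csq.
have F0 n x : D x -> (0 <= (csq (F n x))%:E)%E by move=> _; rewrite lee_fin csq_ge0.
have := fatou mu mD mF F0.
have -> : (\int[mu]_(x in D) limn_einf (fun n => (csq (F n x))%:E) =
           \int[mu]_(x in D) (csq (g x))%:E)%E.
  apply: ae_eq_integral => //.
    (* Measurability of the lower limit follows from that of the upper limit by a change of sign. *)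
    have -> : (fun x => limn_einf (fun n => (csq (F n x))%:E)) =
        (fun x => - limn_esup (fun n => - (csq (F n x))%:E))%E.
      apply/funext => x; rewrite -limn_einfN; congr limn_einf.
      by apply/funext => n; rewrite /= opprK.
    apply: measurableT_comp => //; apply: measurable_fun_limn_esup => n.
    have -> : (fun x => - (csq (F n x))%:E)%E = (fun x => (- csq (F n x))%:E) by [].
    by apply/measurable_EFinP; apply: measurable_funN; apply: measurable_csq; have [] := IF n.
  apply: lebesgue_aeS cF => x /[apply] -[c1 c2].
  have cc : (fun n => (csq (F n x))%:E) @ \oo --> (csq (g x))%:E.
    apply: cvg_EFin; first by near=> n.
    by apply: cvgD; rewrite /= expr2; apply: cvgM.
  by rewrite is_cvg_limn_einfE ?(cvg_lim _ cc)//; apply/cvg_ex; exists (csq (g x))%:E.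
have /limn_einf_le Fl n : (\int[mu]_(x in D) (csq (F n x))%:E <= c%:E)%E.
  have [_ iF] := (L2onP D (F n)).1 (IF n).
  rewrite -[leLHS]fineK ?lee_fin//; first exact: Fc.
  exact: (@integrable_fin_num _ _ _ mu D mD _ iF).
move=> /le_trans/(_ Fl) gc.
split; first by split => //; apply: le_lt_trans gc _; rewrite ltry.
rewrite -lee_fin fineK// ge0_fin_numE.
  by apply: le_lt_trans gc _; rewrite ltry.
by apply: integral_ge0 => x _; rewrite lee_fin csq_ge0.
Unshelve. all: by end_near. Qed.

(** Integrates $|u| \le t + u^2/t$ over an interval of length pi. The parameter [t] stays free, to
    be tuned to the size of [c]. *)
Lemma cint_norm_le f (t c : R) : 0 < t -> L2on D f -> norm2 f <= c ->
  (\int[mu]_(x in D) `|Re (f x)|%:E <= (t * pi + c / t)%:E)%E /\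
  (\int[mu]_(x in D) `|Im (f x)|%:E <= (t * pi + c / t)%:E)%E.
Proof.
move=> t0 If fc.
have [mf iq] := (L2onP D f).1 If.
have [r1 r2] := L2on_L1on If.
have it : mu.-integrable D (EFin \o (fun=> t)).
  by apply: continuous_segment_integrable; exact: cst_continuous.
have itq : mu.-integrable D (EFin \o (fun x => t + csq (f x) * t^-1)).
  rewrite (_ : _ \o _ = (fun x => t%:E + (csq (f x) * t^-1)%:E)%E)//.
  by apply: integrableD => //; exact: (integrable_mulr _ mD iq).
have tq : \int[mu]_(x in D) (t + csq (f x) * t^-1) <= t * pi + c / t.
  rewrite RintegralD//; last exact: (integrable_mulr _ mD iq).
  rewrite RintegralZr//; apply: lerD; last by rewrite ler_wpM2r// invr_ge0 ltW.
  have dt (x : R) : is_derive x (1 : R) (fun x : R => t * x) t.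
    by apply: is_derive_eq; rewrite /GRing.scale /=; ring.
  by rewrite (FTC2_segment (@pi_ge0 R) (@cst_continuous _ _ t) dt) mulr0 subr0.
have H (u : R -> R) : mu.-integrable D (EFin \o u) -> (forall x, u x ^+ 2 <= csq (f x)) ->
    (\int[mu]_(x in D) `|u x|%:E <= (t * pi + c / t)%:E)%E.
  move=> iu uf; have inu := integrable_norm iu.
  rewrite -[leLHS]fineK; last exact: (@integrable_fin_num _ _ _ mu D mD _ inu).
  rewrite lee_fin; apply: le_trans tq; apply: le_Rintegral => // x _.
  have -> : t + csq (f x) * t^-1 = (t ^+ 2 + csq (f x)) / t.
    by field; rewrite gt_eqF.
  rewrite ler_pdivlMr//.
  have := uf x; rewrite -(real_normK (num_real (u x))) => uf'.
  have := sqr_ge0 (`|u x| - t); have := normr_ge0 (u x); nra.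
by split; apply: H => // x; [exact: Re_sqr_le_csq|exact: Im_sqr_le_csq].
Qed.

Lemma geometric_sum_le (n : nat) : \sum_(0 <= j < n) (2^-1 : R) ^+ j <= 2.
Proof.
suff -> : \sum_(0 <= j < n) (2^-1 : R) ^+ j = 2 - 2 * 2^-1 ^+ n.
  by rewrite lerBlDr lerDl mulr_ge0// exprn_ge0.
elim: n => [|n IHn]; first by rewrite big_geq// expr0; ring.
by rewrite big_nat_recr//= IHn exprS; field.
Qed.

End riesz_fischer.

(** * The Riesz-Fischer theorem *)

Section riesz_fischer_theorem.
Variable R : realType.
Local Notation mu := (@lebesgue_measure R).
Local Notation Re := (@complex.Re R).
Local Notation Im := (@complex.Im R).
Local Notation D := (`[0%R, pi]%classic : set R).
Local Notation mD := (@measurable_0pi R).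
Local Notation emi := (@emi R).
Local Notation norm2 := (norm2 D).
Implicit Types (f g : R -> R[i]) (k : int) (a : int -> R[i]) (b : bool).

Definition sqsum b a (N : nat) : R := \sum_(k <- srange b N) csq (a k).

Lemma sqsum_nd b a (N M : nat) : (N <= M)%N -> sqsum b a N <= sqsum b a M.
Proof.
move=> NM; rewrite /sqsum.
have -> : \sum_(k <- srange b N) csq (a k) =
          \sum_(k <- srange b M | k \in srange b N) csq (a k).
  rewrite -[RHS]big_filter; apply: perm_big; apply: uniq_perm.
  - exact: srange_uniq.
  - exact/filter_uniq/srange_uniq.
  - move=> k; rewrite [RHS]mem_filter; apply/idP/andP => [kN|[]//].
    by split => //; exact: (srange_sub NM).
rewrite big_mkcond; apply: ler_sum => k _.
by case: ifP => // _; exact: csq_ge0.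
Qed.

(** The shorter polynomial is the Fourier partial sum of the longer one, so the last term of
    [norm2_sub_trig] vanishes. *)
Lemma norm2_trigB_le b a (N M : nat) : (N <= M)%N ->
  norm2 (fun x => trig a (srange b M) x - trig a (srange b N) x) =
  pi * (sqsum b a M - sqsum b a N).
Proof.
move=> NM; rewrite (norm2_sub_trig _ (srange_uniq b N) (srange_Gamma b N)); last exact: L2on_trig.
have fE k : k \in srange b N -> fourier (trig a (srange b M)) k = a k.
  move=> kN; have kG : k \in Gamma b := allP (srange_Gamma b N) _ kN.
  by rewrite (fourier_trig _ (srange_uniq b M) (srange_Gamma b M) kG) (srange_sub NM kN).
rewrite (norm2_trig _ (srange_uniq b M) (srange_Gamma b M)).
rewrite [X in _ + _ * X]big_seq [X in _ + _ * X]big1 ?mulr0 ?addr0; last first.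
  by move=> k /fE ->; rewrite subrr csq0.
rewrite mulrBr /sqsum; congr (_ - _ * _).
by rewrite big_seq [RHS]big_seq; apply: eq_bigr => k /fE ->.
Qed.

Lemma norm2_trigB b a (N M : nat) (B c : R) : (forall N, sqsum b a N <= B) ->
  B - sqsum b a N <= c -> B - sqsum b a M <= c ->
  norm2 (fun x => trig a (srange b M) x - trig a (srange b N) x) <= pi * c.
Proof.
move=> bB Nc Mc; case: (leqP N M) => [NM|/ltnW MN].
  rewrite norm2_trigB_le// ler_wpM2l ?pi_ge0//; have := bB M; lra.
have -> : norm2 (fun x => trig a (srange b M) x - trig a (srange b N) x) =
    norm2 (fun x => trig a (srange b N) x - trig a (srange b M) x).
  by apply: eq_Rintegral => x _; rewrite -csqN opprB.
rewrite norm2_trigB_le// ler_wpM2l ?pi_ge0//; have := bB N; lra.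
Qed.

(** A subsequence of partial sums with rapidly decreasing tails converges almost everywhere as a
    telescoping series, and Fatou bounds the distance from the limit to each of its terms. The
    approximation clause is what completeness is later derived from. *)
Theorem riesz_fischer b a (C : R) : (forall N, sqsum b a N <= C) ->
  exists g, [/\ L2on D g, forall k, k \in Gamma b -> fourier g k = a k &
    forall e, 0 < e -> exists N, norm2 (fun x => g x - trig a (srange b N) x) <= e].
Proof.
move=> bC.
have cvb : cvgn (sqsum b a).
  apply: nondecreasing_is_cvgn; first by move=> N M; exact: sqsum_nd.
  by exists C => _ [N _ <-].
set B := limn (sqsum b a).
have bB N : sqsum b a N <= B.
  by apply: nondecreasing_cvgn_le => // i j; exact: sqsum_nd.
(* The rate $4^{-j}$ makes the L1 norms of consecutive differences of order $2^{-j}$, which is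
   summable; [j <= N] ensures that every frequency is eventually included. *)
have Nex (j : nat) : {N : nat | (j <= N)%N /\ B - sqsum b a N <= 4^-1 ^+ j}.
  apply: cid; have e0 : (0 : R) < 4^-1 ^+ j by rewrite exprn_gt0.
  have /cvgrPdist_le/(_ _ e0)[N _ hN] := cvb.
  exists (maxn j N); split; first exact: leq_maxl.
  apply: le_trans (ler_norm _) _; apply: hN; exact: leq_maxr.
pose n j := projT1 (Nex j).
have nj j : (j <= n j)%N by have [] := projT2 (Nex j).
have nB j : B - sqsum b a (n j) <= 4^-1 ^+ j by have [] := projT2 (Nex j).
pose T j := trig a (srange b (n j)).
have IT j : L2on D (T j) by exact: L2on_trig.
have e4 (i j : nat) : (i <= j)%N -> (4^-1 : R) ^+ j <= 4^-1 ^+ i.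
  by move=> ij; apply: ler_wiXn2l => //; lra.
have TT i j : (i <= j)%N -> norm2 (fun x => T j x - T i x) <= pi * 4^-1 ^+ i.
  by move=> ij; apply: (norm2_trigB bB) => //; apply: le_trans (nB j) (e4 _ _ ij).
pose P j x := T j.+1 x - T j x.
have IP j : L2on D (P j) by exact: (L2onB mD).
have Pint j : (\int[mu]_(x in D) `|Re (P j x)|%:E <= (2 * pi * 2^-1 ^+ j)%:E)%E /\
              (\int[mu]_(x in D) `|Im (P j x)|%:E <= (2 * pi * 2^-1 ^+ j)%:E)%E.
  have h2 : (0 : R) < 2^-1 ^+ j by rewrite exprn_gt0.
  (* The choice $t = 2^{-j}$ balances the two terms of [cint_norm_le]. *)
  have -> : 2 * pi * 2^-1 ^+ j = 2^-1 ^+ j * pi + (pi * 4^-1 ^+ j) / 2^-1 ^+ j :> R.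
    have -> : (4^-1 : R) ^+ j = 2^-1 ^+ j * 2^-1 ^+ j.
      by rewrite -exprMn; congr (_ ^+ _); field.
    by field; rewrite gt_eqF.
  by apply: cint_norm_le => //; exact: TT.
have sumfin (u : nat -> \bar R) : (forall j, 0 <= u j)%E ->
    (forall j, u j <= (2 * pi * 2^-1 ^+ j)%:E)%E -> (\sum_(0 <= j <oo) u j < +oo)%E.
  move=> u0 uP; apply: (@le_lt_trans _ _ (2 * pi * 2)%:E); last exact: ltry.
  apply: lime_le; first by apply: is_cvg_nneseries => j _ _; exact: u0.
  apply: nearW => m; apply: (@le_trans _ _ (\sum_(0 <= j < m) (2 * pi * 2^-1 ^+ j)%:E)%E).
    by apply: lee_sum => j _.
  rewrite sumEFin lee_fin -mulr_sumr ler_wpM2l ?mulr_ge0 ?pi_ge0//.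
  exact: geometric_sum_le.
have [g1 mg1 cg1] : exists2 g : R -> R, measurable_fun D g &
    {ae mu, forall x, D x -> (fun m => series (fun j => Re (P j x)) m) @ \oo --> g x}.
  apply: (@series_ae_cvg _ (fun j x => Re (P j x))).
    by move=> j; have [[]] := IP j.
  by apply: sumfin => j; [apply: integral_ge0 => x _; rewrite lee_fin|have [] := Pint j].
have [g2 mg2 cg2] : exists2 g : R -> R, measurable_fun D g &
    {ae mu, forall x, D x -> (fun m => series (fun j => Im (P j x)) m) @ \oo --> g x}.
  apply: (@series_ae_cvg _ (fun j x => Im (P j x))).
    by move=> j; have [[]] := IP j.
  by apply: sumfin => j; [apply: integral_ge0 => x _; rewrite lee_fin|have [] := Pint j].
pose g x : R[i] := T 0%N x + (g1 x +i* g2 x).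
have mg : cmeas D g by apply: cmeasD; [have [] := IT 0%N|split].
have cg : {ae mu, forall x, D x -> Re (T m x) @[m --> \oo] --> Re (g x) /\
                                 Im (T m x) @[m --> \oo] --> Im (g x)}.
  have : {ae mu, forall x, (D x -> (fun m => series (fun j => Re (P j x)) m) @ \oo --> g1 x) /\
      (D x -> (fun m => series (fun j => Im (P j x)) m) @ \oo --> g2 x)}.
    by apply: filterI; [exact: (ae_filter_ringOfSetsType mu)|exact: cg1|exact: cg2].
  apply: lebesgue_aeS => x [h1 h2] Dx; move: (h1 Dx) (h2 Dx) => {}h1 {}h2.
  rewrite /g cReD cImD /=; split.
    have -> : (fun m => Re (T m x)) = (fun m => Re (T 0%N x) + series (fun j => Re (P j x)) m).
      apply/funext => m; rewrite /series /=.
      under eq_bigr do rewrite /P cReD cReN.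
      by rewrite telescope_sumr// addrC subrK.
    by apply: cvgD => //; exact: cvg_cst.
  have -> : (fun m => Im (T m x)) = (fun m => Im (T 0%N x) + series (fun j => Im (P j x)) m).
    apply/funext => m; rewrite /series /=.
    under eq_bigr do rewrite /P cImD cImN.
    by rewrite telescope_sumr// addrC subrK.
  by apply: cvgD => //; exact: cvg_cst.
(* Fatou with [i] fixed while the other index tends to infinity. *)
have gT i : L2on D (fun x => g x - T i x) /\ norm2 (fun x => g x - T i x) <= pi * 4^-1 ^+ i.
  apply: (@fatou_norm2 _ (fun m x => T (m + i)%N x - T i x)).
  - by move=> m; exact: (L2onB mD).
  - by move=> m; apply: TT; exact: leq_addl.
  - by apply: cmeasB => //; have [] := IT i.
  apply: lebesgue_aeS cg => x /[apply] -[h1 h2]; split.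
    rewrite cReD cReN.
    have -> : (fun m => Re (T (m + i)%N x - T i x)) = (fun m => Re (T (m + i)%N x) - Re (T i x)).
      by apply/funext => m; rewrite cReD cReN.
    apply: cvgB; last exact: cvg_cst.
    by rewrite (cvg_shiftn i (fun m => Re (T m x))).
  rewrite cImD cImN.
  have -> : (fun m => Im (T (m + i)%N x - T i x)) = (fun m => Im (T (m + i)%N x) - Im (T i x)).
    by apply/funext => m; rewrite cImD cImN.
  apply: cvgB; last exact: cvg_cst.
  by rewrite (cvg_shiftn i (fun m => Im (T m x))).
have Ig : L2on D g.
  have -> : g = (fun x => (g x - T 0%N x) + T 0%N x) by apply/funext => x; rewrite subrK.
  by apply: (L2onD mD) => //; have [] := gT 0%N.
have small (e : R) : 0 < e -> exists i0, forall i, (i0 <= i)%N -> pi * 4^-1 ^+ i <= e.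
  move=> e0.
  have c4 : (fun i => pi * 4^-1 ^+ i) @ \oo --> (pi * 0 : R).
    by apply: cvgM; [exact: cvg_cst|apply: cvg_expr; rewrite ger0_norm; lra].
  have /cvgrPdist_le/(_ _ e0)[i0 _ hi] := c4.
  exists i0 => i /hi; rewrite mulr0 sub0r normrN; exact: le_trans (ler_norm _).
exists g; split => // [k kG|e e0]; last first.
  by have [i /(_ i (leqnn _)) hi] := small e e0; exists (n i); exact: le_trans (gT i).2 hi.
apply/eqP; rewrite -subr_eq0; apply/eqP; apply: csq_eq0; apply/eqP; rewrite eq_le csq_ge0 andbT.
apply/ler_addgt0Pl => e e0; rewrite addr0.
have K0 := norm2_ge0 D (emi k).
have p2 : (0 : R) < pi ^+ 2 by rewrite exprn_gt0 ?pi_gt0.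
(* The factor $\pi^2$ offsets the normalisation of [fourier]; adding 1 keeps the denominator
   positive. *)
have e1 : 0 < e * pi ^+ 2 / (norm2 (emi k) + 1).
  by apply: divr_gt0; [exact: mulr_gt0|exact: ltr_wpDl].
have [i0 hi0] := small _ e1.
(* The maximum puts [k] among the frequencies of [T i], whose coefficient at [k] is then exactly
   [a k]. *)
pose i := maxn i0 `|k|%N.
have ki : k \in srange b (n i).
  by rewrite mem_srange kG; apply: leq_trans (nj i); exact: leq_maxr.
have [IgT ngT] := gT i.
have := cauchy_schwarz mD IgT (@L2on_emi R k).
rewrite cint_fourier (fourierB _ (L2on_L1on Ig) (L2on_L1on (IT i))).
rewrite (fourier_trig _ (srange_uniq b (n i)) (srange_Gamma b (n i)) kG) ki csqM csqR.
have /hi0 hi : (i0 <= i)%N by exact: leq_maxl.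
set x := csq _ => xle.
have : pi ^+ 2 * x <= e * pi ^+ 2.
  apply: le_trans xle _.
  apply: (@le_trans _ _ (e * pi ^+ 2 / (norm2 (emi k) + 1) * norm2 (emi k))).
    by rewrite ler_wpM2r//; exact: le_trans ngT hi.
  rewrite mulrAC ler_pdivrMr ?ltr_wpDl// ler_wpM2l ?lerDl//.
  by rewrite mulr_ge0 ?ltW.
by rewrite mulrC ler_pM2r.
Qed.

End riesz_fischer_theorem.

(** * Uniqueness of Fourier coefficients *)

Section fourier_uniqueness.
Variable R : realType.
Local Notation mu := (@lebesgue_measure R).
Local Notation Re := (@complex.Re R).
Local Notation Im := (@complex.Im R).
Local Notation D := (`[0%R, pi]%classic : set R).
Local Notation mD := (@measurable_0pi R).
Local Notation emi := (@emi R).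
Local Notation norm2 := (norm2 D).
Implicit Types (f g w : R -> R[i]) (k : int) (b : bool).

Lemma derive1_eq_cst (F : R -> R) (c x : R) : 0 < x < pi ->
  (forall y, 0 < y < pi -> F y = c) -> derive1 F x = 0.
Proof.
move=> xD Fc; rewrite derive1E -(@derive_cst R R R c x (1 : R)).
apply: near_eq_derive.
have xI : x \in `]0, pi[ by rewrite in_itv.
by near=> y; apply: Fc; near: y; have := near_in_itvoo xI; apply: filterS => y; rewrite in_itv.
Unshelve. all: by end_near. Qed.

Lemma ae_neq (c : R) : {ae mu, forall x : R, x <> c}.
Proof.
exists [set c]; split; first exact: measurable_set1.
  exact: lebesgue_measure_set1.
by move=> x /= /contrapT.
Qed.

(** At a Lebesgue point inside the interval the primitive has derivative [g x], while a constant has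
    derivative 0; the endpoints are discarded as a null set. *)
Lemma ae_eq0_primitive_cst (g : R -> R) (c : R) :
  mu.-integrable D (EFin \o g) ->
  (forall x, 0 < x < pi -> \int[mu]_(t in `[0%R, x]) g t = c) ->
  {ae mu, forall x, D x -> g x = 0}.
Proof.
move=> ig gc.
have lg := lebesgue_differentiation (integrable_locally mD ig).
have : {ae mu, forall x, (lebesgue_pt (g \_ D) x /\ x <> 0) /\ x <> pi}.
  apply: filterI; [exact: (ae_filter_ringOfSetsType mu)| |exact: ae_neq].
  apply: filterI; [exact: (ae_filter_ringOfSetsType mu)| |exact: ae_neq].
  exact: lg.
apply: lebesgue_aeS => x [[xl /eqP x0] /eqP xpi] Dx.
have /andP[x0' xpi'] : 0 <= x <= pi by move: Dx; rewrite /= in_itv.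
have x0p : 0 < x by rewrite lt_neqAle eq_sym x0.
have xpip : x < pi by rewrite lt_neqAle xpi.
have igD : mu.-integrable `[0, pi] (EFin \o (g \_ D)).
  have h := (@integrable_mkcond _ _ _ mu D (EFin \o g) mD).1 ig.
  by rewrite restrict_EFin in h; apply: integrableS h.
have [_] := @FTC1_lebesgue_pt _ _ (BLeft 0) x pi xpip igD x0p xl.
rewrite patchE mem_set// => <-; apply: (derive1_eq_cst (c := c)); first by rewrite x0p xpip.
move=> y yI; rewrite -(gc y yI); apply: eq_Rintegral => t /set_mem /=.
rewrite in_itv /= => /andP[t0 ty]; rewrite patchE mem_set//= in_itv /= t0.
by have /andP[_ /ltW] := yI; exact: le_trans.
Qed.

(** Continuity yields every interior point, not almost every one: the result has to serve as the
    pointwise hypothesis of [ae_eq0_primitive_cst]. *)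
Lemma continuous_eq0_primitive_cst (g : R -> R) (c : R) :
  {within D, continuous g} ->
  (forall x, 0 < x < pi -> \int[mu]_(t in `[0%R, x]) g t = c) ->
  forall x, 0 < x < pi -> g x = 0.
Proof.
move=> cg gc x xI; have /andP[x0 xpi] := xI.
have ig : mu.-integrable D (EFin \o g).
  by apply: continuous_compact_integrable => //; exact: segment_compact.
have cgx : {for x, continuous g}.
  have /(continuous_within_itvP _ (@pi_gt0 R))[+ _ _] := cg.
  by apply; rewrite in_itv.
have [_ <-] := continuous_FTC1_closed xpi ig x0 cgx.
exact: (derive1_eq_cst (c := c)).
Qed.

(** With $s = |x - x_0| \le 2u_0 < \pi$ one has $\sin s = 2\sin(s/2)\cos(s/2) \ge s\cos^2 u_0$,
    because $s/2 \le u_0 < \pi/2$ and $\sin u \ge u\cos u_0$ on $[0,u_0]$ by the mean value theorem;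
    squaring gives $c = \cos^4 u_0$. For [x0] at an endpoint the sine would also vanish at the other
    end. *)
Lemma sin_lower (x0 : R) : 0 < x0 < pi -> exists2 c, 0 < c &
  forall x, D x -> c * (x - x0) ^+ 2 <= sin (x - x0) ^+ 2.
Proof.
move=> /andP[x00 x0pi].
pose u0 := Num.max x0 (pi - x0) / 2.
have u00 : 0 < u0 by rewrite divr_gt0// lt_max x00.
have u0pi : u0 < pi / 2 by rewrite ltr_pM2r ?invr_gt0// gt_max x0pi/= ltrBlDr ltrDl.
have pi0 := @pi_gt0 R.
have c0 : 0 < cos u0 by apply: cos_gt0_pihalf; rewrite u0pi andbT; lra.
have cle u : 0 <= u <= u0 -> cos u0 <= cos u.
  move=> /andP[u_ge0]; rewrite le_eqVlt => /predU1P[->//|uu0].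
  by apply/ltW; rewrite ltr_cos// in_itv /=; apply/andP; split; lra.
have sle u : 0 <= u <= u0 -> u * cos u0 <= sin u.
  move=> /andP[]; rewrite le_eqVlt => /predU1P[<-|u_gt0 uu0]; first by rewrite mul0r sin0.
  have [|xi xiI] := @MVT R sin cos 0 u u_gt0 (fun x _ => is_derive_sin x).
    by apply: continuous_subspaceT; exact: continuous_sin.
  rewrite sin0 !subr0 => ->; rewrite mulrC; apply: ler_wpM2r; first exact: ltW.
  by apply: cle; move: xiI; rewrite in_itv /= => /andP[? ?]; apply/andP; split; lra.
have s2 s : 0 <= s <= u0 * 2 -> s * cos u0 ^+ 2 <= sin s.
  move=> /andP[s0 su].
  have hs : 0 <= s / 2 <= u0 by apply/andP; split; lra.
  have -> : sin s = 2 * sin (s / 2) * cos (s / 2).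
    by rewrite [in LHS](_ : s = s / 2 + s / 2) ?sinD; [ring|lra].
  have h1 := sle _ hs; have h2 := cle _ hs.
  have h3 : 0 <= s / 2 * cos u0 by apply: mulr_ge0; [lra|exact: ltW].
  have := ler_pM h3 (ltW c0) h1 h2; rewrite expr2; lra.
exists (cos u0 ^+ 4); first by rewrite exprn_gt0.
move=> x; rewrite /= in_itv /= => /andP[xl xr].
have : 0 <= `|x - x0| <= u0 * 2.
  rewrite normr_ge0 /= /u0 divfK ?pnatr_eq0// le_max.
  by case: (leP 0 (x - x0)) => [h|/ltW h]; rewrite ?(ger0_norm h) ?(ler0_norm h); apply/orP; [right|left]; lra.
move=> h; have := s2 _ h.
have -> : sin (x - x0) ^+ 2 = sin `|x - x0| ^+ 2.
  by case: (leP 0 (x - x0)) => [h'|/ltW h']; rewrite ?(ger0_norm h') ?(ler0_norm h')// sinN sqrrN.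
move=> h'; rewrite -(real_normK (num_real (x - x0))).
have -> : cos u0 ^+ 4 * `|x - x0| ^+ 2 = (`|x - x0| * cos u0 ^+ 2) ^+ 2 by ring.
have h0 : 0 <= `|x - x0| * cos u0 ^+ 2 by rewrite mulr_ge0 ?exprn_ge0// (ltW c0).
by rewrite ler_sqr ?nnegrE//; exact: le_trans h'.
Qed.

Lemma measurable_inv : measurable_fun [set: R] (@GRing.inv R).
Proof.
have -> : [set: R] = [set~ 0] `|` [set 0] by rewrite setUC setUv.
apply/measurable_funU; [by apply: measurableC; exact: measurable_set1|exact: measurable_set1|split].
  apply: open_continuous_measurable_fun.
    by rewrite openC; exact: closed_eq.
  by move=> x /set_mem /= /eqP x0; exact: inv_continuous.
refine (@eq_measurable_fun _ _ _ _ ([set 0] : set R) (fun=> (0:R)) _ _ _); last exact: measurable_cst.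
by move=> x /set_mem ->; rewrite invr0.
Qed.


Lemma fourier_cst (z : R[i]) k : k \in Gamma true ->
  fourier (fun=> z) k = if k == 0 then z else 0.
Proof.
move=> kG; rewrite (@eq_fourier _ _ (fun x => z * emi (- 0) x)); last first.
  by move=> x _; rewrite oppr0 emi0 mulr1.
rewrite fourierZ; last by apply: L2on_L1on; exact: L2on_emi.
rewrite (@fourier_emi R true k 0 kG); last by rewrite mem_Gamma.
by case: eqP; rewrite ?mulr1 ?mulr0.
Qed.

Lemma double_Gamma (j : int) : j + j \in Gamma true.
Proof. by rewrite mem_Gamma; lia. Qed.

Lemma nat_bounded_le0 (t M : R) : (forall n : nat, t * n%:R <= M) -> t <= 0.
Proof.
move=> tM; rewrite leNgt; apply/negP => t0.
have := tM (Num.truncn (M / t)).+1.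
rewrite mulrC -ler_pdivlMr// leNgt => /negP; apply.
by apply: truncnS_gt.
Qed.

(** Bessel bounds [n * t] uniformly in [n]. This stands in for the decay of Fourier coefficients in
    the telescoping argument. *)
Lemma bessel_cst f (u : nat -> int) (t : R) : L2on D f -> injective u ->
  (forall n, u n \in Gamma true) -> (forall n, csq (fourier f (u n)) = t) -> t = 0.
Proof.
move=> If uI uG ut; apply/eqP; rewrite eq_le; apply/andP; split; last first.
  by rewrite -(ut 0%N) csq_ge0.
apply: (@nat_bounded_le0 _ (norm2 f / pi)) => n.
rewrite ler_pdivlMr ?pi_gt0// mulrC.
apply: le_trans (@bessel _ true f [seq u j | j <- iota 0 n] _ _ If).
- rewrite ler_wpM2l ?pi_ge0// big_map (eq_bigr (fun=> t)) => [|j _]; last exact: ut.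
  by rewrite big_const_seq count_predT size_iota iter_addr_0 mulr_natr.
- by rewrite map_inj_uniq ?iota_uniq.
- by apply/allP => k /mapP[j _ ->]; exact: uG.
Qed.

(* Chernoff's argument: dividing [G - G x0] by [1 - e^{2i(x - x0)}] gives a bounded function [h],
   and the Fourier coefficients of [G - G x0] telescope in those of [h]. *)
Lemma fourier_constant G (M x0 : R) : 0 < x0 < pi -> 0 <= M -> L2on D G ->
  (forall x, D x -> csq (G x - G x0) <= M * (x - x0) ^+ 2) ->
  (forall k, k \in Gamma true -> k != 0 -> fourier G k = 0) ->
  G x0 = fourier G 0.
Proof.
move=> x0I M0 IG GM G0; have [mG _] := IG.
have [c c0 hc] := sin_lower x0I.
(* This is $1 - e^{2i(x - x_0)}$. The frequency 2 keeps shifted indices even, and the only zero on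
   $[0,\pi]$ is $x_0$. *)
pose d x : R[i] := 1 - emi 2 x0 * emi (- 2) x.
pose p x : R[i] := G x - G x0.
(* Division by [d], as the conjugate over the squared modulus; the inverse of 0 is 0, so [h]
   vanishes where [d] does. *)
pose h x : R[i] := p x * (cj (d x) * ((csq (d x))^-1)%:C).
have dE x : csq (d x) = 4 * sin (x - x0) ^+ 2.
  have -> : d x = 1 - (cos ((x - x0) + (x - x0)) +i* sin ((x - x0) + (x - x0))).
    rewrite /d; congr (1 - _).
    have -> : (x - x0) + (x - x0) = 2%:~R * x - 2%:~R * x0 by ring.
    by apply: complex_ext; rewrite !ReImE /emi /= rmorphN /= mulNr cosN sinN ?cosB ?sinB; ring.
  have -> (u v : R) : csq (1 - (u +i* v)) = (1 - u) ^+ 2 + v ^+ 2.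
    by rewrite /csq !ReImE /= sub0r sqrrN.
  move: (x - x0) => t; rewrite cosD sinD.
  have := sin2cos2 t; move: (sin t) (cos t) => S C S2.
  have -> : 1 - (C * C - S * S) = 2 * S ^+ 2 by rewrite -(expr2 C) -(expr2 S) S2; ring.
  have -> : S * C + C * S = 2 * S * C by ring.
  have C2 : C ^+ 2 = 1 - S ^+ 2 by rewrite S2; ring.
  by rewrite !exprMn C2; ring.
have mp : cmeas D p by apply: cmeasB => //; exact: cmeas_cst.
have md : cmeas D d.
  apply: cmeasB; first exact: cmeas_cst.
  by apply: cmeasM; [exact: cmeas_cst|exact: cmeas_emi mD].
have mh : cmeas D h.
  apply: cmeasM => //; apply: cmeasM; first exact: cmeasJ.
  split => /=; last exact: measurable_cst.
  apply: (measurableT_comp measurable_inv); exact: measurable_csq.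
have pdh x : D x -> p x = h x * d x.
  (* Where [d] vanishes, [hc] forces [x = x0] and the hypothesis on [G] gives [p x = 0], so the
     factorisation survives. *)
  move=> Dx; have [d0|d0] := eqVneq (csq (d x)) 0.
    have d0' := csq_eq0 d0.
    rewrite d0' mulr0; apply: csq_eq0; apply/eqP; rewrite eq_le csq_ge0 andbT.
    apply: le_trans (GM x Dx) _.
    have := hc x Dx; move/eqP: d0; rewrite dE mulf_eq0 pnatr_eq0/= => /eqP ->.
    rewrite pmulr_rle0// => s0.
    by have -> : (x - x0) ^+ 2 = 0; [apply/eqP; rewrite eq_le s0 sqr_ge0|rewrite mulr0].
  rewrite /h -mulrA [cj _ * _]mulrC -mulrA [cj _ * _]mulrC -csq_conj -rmorphM /= mulVf//.
  by rewrite mulr1.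
have Ih : L2on D h.
  (* The numerator is at most $M(x - x_0)^2$ and the denominator at least $4c(x - x_0)^2$. *)
  apply: (L2on_le mD (b := fun=> M / (4 * c))) => // [|x Dx].
    by apply: continuous_segment_integrable; exact: cst_continuous.
  have K0 : 0 <= M / (4 * c) by rewrite divr_ge0// mulr_ge0// ltW.
  rewrite /h !csqM csqJ csqR.
  have [->|d0] := eqVneq (csq (d x)) 0; first by rewrite mul0r mulr0.
  have dp : 0 < csq (d x) by rewrite lt_neqAle eq_sym d0 csq_ge0.
  have -> : csq (p x) * (csq (d x) * (csq (d x))^-1 ^+ 2) = csq (p x) / csq (d x).
    by field.
  rewrite ler_pdivrMr//; apply: le_trans (GM x Dx) _.
  have -> : M / (4 * c) * csq (d x) = M * (csq (d x) / (4 * c)) by ring.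
  rewrite ler_wpM2l// ler_pdivlMr ?mulr_gt0// dE.
  by have := hc x Dx; lra.
have Ip : L2on D p by apply: (L2onB mD) => //; exact: L2on_cst.
have pk k : fourier p k = fourier h k - emi 2 x0 * fourier h (k - 2).
  rewrite -fourier_Memi.
  have IhE := L2on_L1on (L2on_Memi (- 2) Ih).
  rewrite -fourierZ// -fourierB; [|exact: L2on_L1on|exact: (L1onZ mD)].
  by apply: eq_fourier => x /set_mem Dx; rewrite pdh// /d; ring.
have pk0 k : k \in Gamma true -> k != 0 -> fourier p k = 0.
  move=> kG k0; rewrite fourierB; [|exact: L2on_L1on|exact/L2on_L1on/L2on_cst].
  by rewrite G0// fourier_cst// (negbTE k0) subr0.
(* The relation links [k] to [k - 2] except at [k = 0], so the moduli are constant separately on the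
   even frequencies from 0 up and on those from -2 down. *)
have hk k : k \in Gamma true -> k != 0 -> csq (fourier h k) = csq (fourier h (k - 2)).
  move=> kG k0; have /eqP := pk k; rewrite pk0// eq_sym subr_eq0 => /eqP ->.
  by rewrite csqM csq_emi mul1r.
have h0 : fourier h 0 = 0.
  apply: csq_eq0; apply: (@bessel_cst h (fun n => n%:Z + n%:Z)) => //.
  - by move=> m n; lia.
  - by move=> n; exact: double_Gamma.
  - elim=> [|n IHn]; first by rewrite addr0.
    by rewrite hk ?double_Gamma//; rewrite -IHn; congr (csq (fourier h _)); lia.
have h2 : fourier h (0 - 2) = 0.
  apply: csq_eq0; apply: (@bessel_cst h (fun n => - (n.+1%:Z + n.+1%:Z))) => //.
  - by move=> m n; lia.
  - by move=> n; rewrite mem_Gamma; lia.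
  - elim=> [|n IHn]; first by congr (csq (fourier h _)); lia.
    rewrite -IHn [RHS]hk; [|by rewrite mem_Gamma; lia|by lia].
    by congr (csq (fourier h _)); lia.
have := pk 0; rewrite h0 h2 mulr0 subr0.
rewrite fourierB; [|exact: L2on_L1on|exact/L2on_L1on/L2on_cst].
by rewrite fourier_cst ?mem_Gamma// eqxx => /eqP; rewrite subr_eq0 => /eqP.
Qed.

(** A vanishing zeroth coefficient is a vanishing integral over $[0,\pi]$, which removes the
    boundary term of [cint_by_parts0]; division by $ik$ does the rest. *)
Lemma fourier_primitive0 w k : L1on D w -> k \in Gamma true -> k != 0 ->
  fourier w 0 = 0 -> fourier w k = 0 -> fourier (fun x => cint `[0%R, x] w) k = 0.
Proof.
move=> Iw kG k0 w0 wk.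
have Dw : cint D w = 0.
  have := cint_fourier w 0; rewrite w0 mulr0 => <-.
  by apply: eq_cint => x _; rewrite emi0 mulr1.
have := cint_by_parts0 k Iw.
rewrite cint_fourier wk mulr0 Dw mul0r add0r cint_fourier mulrA => /esym/eqP.
have i0 : ('i : R[i]) != 0 by apply/eqP => /(congr1 Im)/= /eqP; rewrite oner_eq0.
have k0' : ((k%:~R : R)%:C : R[i]) != 0 by apply: realC_neq0; rewrite intr_eq0.
rewrite mulf_eq0 => /orP[|/eqP//].
by rewrite !mulf_eq0 (negbTE i0) (negbTE k0') (negbTE (realC_neq0 (@pi_neq0 R))).
Qed.

Lemma primitive_lipschitz (g : R -> R) (M x y : R) : mu.-integrable D (EFin \o g) ->
  (forall t, D t -> `|g t| <= M) -> D x -> D y -> x <= y ->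
  `|\int[mu]_(t in `[0%R, y]) g t - \int[mu]_(t in `[0%R, x]) g t| <= M * (y - x).
Proof.
move=> ig gM; rewrite /= !in_itv /= => /andP[x0 xp] /andP[y0 yp] xy.
have sub : `]x, y] `<=` D.
  by move=> t; rewrite /= !in_itv /= => /andP[xt ty]; apply/andP; split; lra.
have igy : mu.-integrable `[0, y] (EFin \o g).
  by apply: integrableS ig => //; apply: subset_itvl; rewrite bnd_simp.
have igxy : mu.-integrable `]x, y] (EFin \o g) by exact: integrableS ig.
rewrite Rintegral_itvB// ?bnd_simp//.
apply: le_trans (le_normr_Rintegral _ igxy) _ => //.
apply: (@le_trans _ _ (\int[mu]_(t in `]x, y]) M)).
  apply: le_Rintegral => //; first exact: (integrable_norm igxy).
    apply: (@integrableS _ _ _ mu D) => //.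
    by apply: continuous_segment_integrable; exact: cst_continuous.
  by move=> t /sub; exact: gM.
have c1 : mu.-integrable `[0, y] (EFin \o (fun=> M)).
  by apply: continuous_segment_integrable; exact: cst_continuous.
have dM (t : R) : is_derive t (1 : R) (fun t : R => M * t) M.
  by apply: is_derive_eq; rewrite /GRing.scale /=; ring.
have FT z : 0 <= z -> \int[mu]_(t in `[0%R, z]) M = M * z.
  by move=> z0; rewrite (FTC2_segment z0 (@cst_continuous _ _ M) dM) mulr0 subr0.
by rewrite -(Rintegral_itvB c1) ?bnd_simp// !FT// mulrBr.
Qed.

(** The primitive of [w] is Lipschitz and its even coefficients vanish except for the zeroth, so
    [fourier_constant] applies at each interior point; the constant is the mean. *)
Lemma bounded_fourier_eq0_primitive w (M : R) : cmeas D w ->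
  (forall x, D x -> `|Re (w x)| <= M /\ `|Im (w x)| <= M) ->
  (forall k, k \in Gamma true -> fourier w k = 0) ->
  exists z, forall x, 0 < x < pi -> cint `[0%R, x] w = z.
Proof.
move=> mw wM w0.
have Iw := L2on_L1on (bounded_L2on mw wM); have [w1 w2] := Iw.
pose G x : R[i] := cint `[0%R, x] w.
have IG : L2on D G := primitive_L2on Iw (primitive_cint w).
exists (fourier G 0) => x0 x0I; have /andP[x00 x0pi] := x0I.
have Dx0 : D x0 by rewrite /= in_itv /= !ltW.
(* The real and imaginary parts contribute [M ^+ 2] each. *)
apply: (@fourier_constant G (2 * M ^+ 2) x0 x0I) => //.
- by rewrite mulr_ge0 ?sqr_ge0.
- move=> x Dx.
  have lip (g : R -> R) : mu.-integrable D (EFin \o g) -> (forall t, D t -> `|g t| <= M) ->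
      (\int[mu]_(t in `[0%R, x]) g t - \int[mu]_(t in `[0%R, x0]) g t) ^+ 2
      <= M ^+ 2 * (x - x0) ^+ 2.
    move=> ig gM; have M0 : 0 <= M by apply: le_trans (gM _ Dx0).
    rewrite -exprMn -(real_normK (num_real (_ - _))) -[leRHS](real_normK (num_real _)).
    rewrite ler_sqr ?nnegrE// normrM (ger0_norm M0).
    have [xx0|/ltW x0x] := leP x x0.
      by rewrite distrC [`|x - x0|]distrC (ger0_norm (_ : 0 <= x0 - x)) ?subr_ge0//; exact: primitive_lipschitz.
    by rewrite (ger0_norm (_ : 0 <= x - x0)) ?subr_ge0//; exact: primitive_lipschitz.
  have l1 := lip _ w1 (fun t Dt => (wM t Dt).1).
  have l2 := lip _ w2 (fun t Dt => (wM t Dt).2).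
  have := lerD l1 l2; rewrite /csq /G !ReImE /=; lra.
- by move=> k kG k0; apply: fourier_primitive0 => //; apply: w0 => //; rewrite mem_Gamma.
Qed.

Lemma fourier_eq0_even f : L2on D f ->
  (forall k, k \in Gamma true -> fourier f k = 0) -> {ae mu, forall x, D x -> f x = 0}.
Proof.
move=> If f0; have If1 := L2on_L1on If; have [f1 f2] := If1.
pose F x : R[i] := cint `[0%R, x] f.
have FP : primitive_on F f := primitive_cint f.
have IF : L2on D F := primitive_L2on If1 FP.
(* Subtracting the mean makes the zeroth coefficient vanish as well, as the second integration
   requires. *)
pose w x := F x - fourier F 0.
have Iw : L2on D w by apply: (L2onB mD) => //; exact: L2on_cst.
have [M M0 FM] := primitive_bounded If1 FP.
have wk k : k \in Gamma true -> fourier w k = 0.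
  move=> kG; rewrite fourierB; [|exact: L2on_L1on|exact/L2on_L1on/L2on_cst].
  rewrite fourier_cst//; case: eqVneq => [->|k0]; first by rewrite subrr.
  by rewrite subr0; apply: fourier_primitive0 => //; apply: f0 => //; rewrite mem_Gamma.
have wM x : D x -> `|Re (w x)| <= M + (`|Re (fourier F 0)| + `|Im (fourier F 0)|) /\
    `|Im (w x)| <= M + (`|Re (fourier F 0)| + `|Im (fourier F 0)|).
  move=> /FM[m1 m2]; rewrite /w; move: (fourier F 0) (F x) m1 m2 => z z' m1 m2.
  rewrite !ReImE; split; apply: le_trans (ler_normB _ _) _; apply: lerD => //.
    by rewrite lerDl.
  by rewrite lerDr.
have [z wz] := bounded_fourier_eq0_primitive (proj1 Iw) wM wk.
have c1 : {within D, continuous (fun x => Re (w x))}.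
  have h := primitive_within_continuous f1 (c := - Re (fourier F 0)).
  have -> : (fun x => Re (w x)) =
      (fun x => - Re (fourier F 0) + \int[mu]_(t in `[0%R, x]) Re (f t)).
    by apply/funext => x; rewrite /w !ReImE addrC.
  exact: h.
have c2 : {within D, continuous (fun x => Im (w x))}.
  have h := primitive_within_continuous f2 (c := - Im (fourier F 0)).
  have -> : (fun x => Im (w x)) =
      (fun x => - Im (fourier F 0) + \int[mu]_(t in `[0%R, x]) Im (f t)).
    by apply/funext => x; rewrite /w !ReImE addrC.
  exact: h.
have w1 := continuous_eq0_primitive_cst c1 (c := Re z).
have w2 := continuous_eq0_primitive_cst c2 (c := Im z).
have FF x : 0 < x < pi -> F x = fourier F 0.
  move=> xI; apply/eqP; rewrite -subr_eq0; apply/eqP; apply: complex_ext.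
    by apply: w1 => // y /wz <-.
  by apply: w2 => // y /wz <-.
have a1 : {ae mu, forall x, D x -> Re (f x) = 0}.
  by apply: (@ae_eq0_primitive_cst _ (Re (fourier F 0)) f1) => x /FF <-.
have a2 : {ae mu, forall x, D x -> Im (f x) = 0}.
  by apply: (@ae_eq0_primitive_cst _ (Im (fourier F 0)) f2) => x /FF <-.
have : {ae mu, forall x, (D x -> Re (f x) = 0) /\ (D x -> Im (f x) = 0)}.
  by apply: filterI; [exact: (ae_filter_ringOfSetsType mu)|exact: a1|exact: a2].
by apply: lebesgue_aeS => x [h1 h2] Dx; apply: complex_ext; [exact: h1|exact: h2].
Qed.

(** Multiplication by $e^{-ix}$ exchanges odd and even frequencies and has no zeros, which reduces
    the antiperiodic case to the even one. *)
Theorem fourier_eq0 b f : L2on D f ->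
  (forall k, k \in Gamma b -> fourier f k = 0) -> {ae mu, forall x, D x -> f x = 0}.
Proof.
case: b => If f0; first exact: fourier_eq0_even.
have := @fourier_eq0_even _ (L2on_Memi 1 If).
have h k : k \in Gamma true -> fourier (fun x => f x * emi 1 x) k = 0.
  move=> kG; rewrite fourier_Memi; apply: f0.
  by move: kG; rewrite !mem_Gamma; lia.
move=> /(_ h); apply: lebesgue_aeS => x /[apply] /eqP.
by rewrite mulf_eq0 (negbTE (emi_neq0 _ _)) orbF => /eqP.
Qed.

End fourier_uniqueness.

(** * Completeness, Parseval's identity and the series with the coefficients of $V$ *)

Section periodic_operators.
Variable R : realType.
Local Notation mu := (@lebesgue_measure R).
Local Notation Re := (@complex.Re R).
Local Notation Im := (@complex.Im R).
Local Notation D := (`[0%R, pi]%classic : set R).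
Local Notation mD := (@measurable_0pi R).
Local Notation emi := (@emi R).
Local Notation norm2 := (norm2 D).
Implicit Types (f g h Y Q y : R -> R[i]) (k : int) (b : bool).

(** Bessel bounds the coefficients, [riesz_fischer] returns a [g] with the same ones, and
    [fourier_eq0] identifies it with [f]. One good index suffices, since by the error formula the
    distance does not increase with [N]. *)
Lemma trig_cvg b f (e : R) : L2on D f -> 0 < e -> exists N0, forall N, (N0 <= N)%N ->
  norm2 (fun x => f x - trig (fourier f) (srange b N) x) <= e.
Proof.
move=> If e0.
have norm2T N : norm2 (fun x => f x - trig (fourier f) (srange b N) x) =
    norm2 f - pi * sqsum b (fourier f) N.
  rewrite (norm2_sub_trig _ (srange_uniq b N) (srange_Gamma b N) If).
  by rewrite [X in _ + _ * X]big1 ?mulr0 ?addr0// => k _; rewrite subrr csq0.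
have sb N : sqsum b (fourier f) N <= norm2 f / pi.
  rewrite ler_pdivlMr ?pi_gt0// mulrC.
  exact: (bessel (srange_uniq b N) (srange_Gamma b N) If).
have [g [Ig gf /(_ e e0)[N0 hN0]]] := riesz_fischer sb.
have fg : {ae mu, forall x, D x -> f x - g x = 0}.
  apply: (@fourier_eq0 _ b); first exact: (L2onB mD).
  by move=> k kG; rewrite fourierB ?gf ?subrr//; exact: L2on_L1on.
have IT := @L2on_trig R (fourier f) (srange b N0).
exists N0 => N NN; rewrite norm2T; apply: (@le_trans _ _ (norm2 f - pi * sqsum b (fourier f) N0)).
  by rewrite lerD2l lerN2 ler_wpM2l ?pi_ge0// sqsum_nd.
rewrite -norm2T; apply: le_trans hN0; rewrite le_eqVlt; apply/orP; left; apply/eqP.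
apply: (ae_eq_norm2 mD).
- by have [] := L2onB mD If IT.
- by have [] := L2onB mD Ig IT.
- by apply: lebesgue_aeS fg => x /[apply] /eqP; rewrite subr_eq0 => /eqP ->.
Qed.

(** Componentwise, to match the two real limits in [zseries]. *)
Definition ccvg (u : nat -> R[i]) (l : R[i]) :=
  (Re (u N) @[N --> \oo] --> Re l) /\ (Im (u N) @[N --> \oo] --> Im l).

Lemma ccvgP (u : nat -> R[i]) (l : R[i]) :
  (forall e, 0 < e -> exists N0, forall N, (N0 <= N)%N -> csq (l - u N) <= e) -> ccvg u l.
Proof.
move=> H; split; apply/cvgrPdist_le => e e0;
  have e2 : 0 < e ^+ 2 by [rewrite exprn_gt0];
  have [N0 hN] := H _ e2; exists N0 => // N /hN ule;
  rewrite -ler_sqr ?nnegrE ?(ltW e0)// real_normK ?num_real//; apply: le_trans ule.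
  by rewrite -cReN -cReD; exact: Re_sqr_le_csq.
by rewrite -cImN -cImD; exact: Im_sqr_le_csq.
Qed.

Lemma ccvgB u v (l m : R[i]) : ccvg u l -> ccvg v m -> ccvg (fun N => u N - v N) (l - m).
Proof.
move=> [u1 u2] [v1 v2]; split; rewrite ?cReD ?cImD ?cReN ?cImN.
  under eq_cvg do rewrite cReD cReN.
  exact: cvgB.
under eq_cvg do rewrite cImD cImN.
exact: cvgB.
Qed.

Lemma ccvgZ u (z l : R[i]) : ccvg u l -> ccvg (fun N => z * u N) (z * l).
Proof.
move=> [u1 u2]; split; rewrite ?cReM ?cImM.
  under eq_cvg do rewrite cReM.
  by apply: cvgB; apply: cvgM => //; exact: cvg_cst.
under eq_cvg do rewrite cImM.
by apply: cvgD; apply: cvgM => //; exact: cvg_cst.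
Qed.

(** The difference is $\frac1\pi\int h(f - S_N f)$ with $S_N f$ the partial sum, so only [f] is
    expanded and Cauchy-Schwarz concludes. The pairing has no conjugate, whence the index [- k] on
    [h]. *)
Lemma parseval b f h : L2on D f -> L2on D h ->
  ccvg (fun N => \sum_(k <- srange b N) fourier f k * fourier h (- k))
       ((pi^-1)%:C * cint D (fun x => f x * h x)).
Proof.
move=> If Ih; apply: ccvgP => e e0.
have h0 := norm2_ge0 D h.
have e1 : 0 < e * pi ^+ 2 / (norm2 h + 1).
  by apply: divr_gt0; [rewrite mulr_gt0// exprn_gt0// pi_gt0|exact: ltr_wpDl].
have [N0 hN0] := trig_cvg b If e1.
exists N0 => N /hN0 ngT.
have IT := @L2on_trig R (fourier f) (srange b N).
have := cauchy_schwarz mD Ih (L2onB mD If IT).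
have -> : cint D (fun x => h x * (f x - trig (fourier f) (srange b N) x)) =
   (pi : R)%:C * ((pi^-1)%:C * cint D (fun x => f x * h x) -
     \sum_(k <- srange b N) fourier f k * fourier h (- k)).
  rewrite mulrBr mulrA piVK mul1r -(cint_mul_trig _ _ Ih).
  rewrite -(cintB mD (L1on_ML2 mD If Ih) (L1on_ML2 mD Ih IT)).
  by apply: eq_cint => x _; ring.
rewrite csqM csqR => xle.
have p2 : (0 : R) < pi ^+ 2 by rewrite exprn_gt0 ?pi_gt0.
rewrite -(ler_pM2l p2); apply: le_trans xle _.
apply: (@le_trans _ _ (norm2 h * (e * pi ^+ 2 / (norm2 h + 1)))); first by rewrite ler_wpM2l.
rewrite mulrA ler_pdivrMr ?ltr_wpDl// mulrC [pi ^+ 2 * e]mulrC ler_wpM2l ?lerDl//.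
by rewrite mulr_ge0 ?ltW.
Qed.

Lemma mulii : 'i * 'i = -1 :> R[i].
Proof. by rewrite -expr2 sqr_i. Qed.

(* The product rule [V(k-m) = i(k-m) q(k-m)] splits the series into the convolutions of [q] with
   the coefficients of [Y] and of [g = Y']. *)
Lemma zseries_Vcoef b Q Y g k : L2on D Q -> L2on D Y -> L2on D g ->
  (forall m, m \in Gamma b -> fourier g m = 'i * (m%:~R)%:C * fourier Y m) ->
  zseries (fun m => if (m \in Gamma b) && (m != k) then Vcoef Q (k - m) * fourier Y m else 0) =
  'i * (k%:~R)%:C * fourier (fun x => Q x * Y x) k - fourier (fun x => Q x * g x) k.
Proof.
move=> IQ IY Ig gY; set a := fun m => _.
have a0 m : m \notin Gamma b -> a m = 0 by rewrite /a => /negbTE ->.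
have P f : L2on D f -> ccvg (fun N => \sum_(m <- srange b N) fourier f m * fourier Q (k - m))
    (fourier (fun x => Q x * f x) k).
  (* Parseval against $Q e^{-ikx}$, whose coefficient at [- m] is that of [Q] at [k - m]. *)
  move=> If; have := parseval b If (L2on_Memi k IQ).
  have -> : (pi^-1)%:C * cint D (fun x => f x * (Q x * emi k x)) = fourier (fun x => Q x * f x) k.
    by congr (_ * _); apply: eq_cint => x _; rewrite -/(emi k x); ring.
  have -> // : (fun N => \sum_(m <- srange b N) fourier f m * fourier (fun x => Q x * emi k x) (- m)) =
    (fun N => \sum_(m <- srange b N) fourier f m * fourier Q (k - m)).
  by apply/funext => N; apply: eq_bigr => m _; rewrite fourier_Memi addrC.
have c := ccvgB (ccvgZ ('i * (k%:~R)%:C) (P _ IY)) (P _ Ig).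
have aE N : symsum a N = 'i * (k%:~R)%:C * (\sum_(m <- srange b N) fourier Y m * fourier Q (k - m)) -
    \sum_(m <- srange b N) fourier g m * fourier Q (k - m).
  rewrite (symsum_srange _ a0) mulr_sumr -sumrB big_seq [RHS]big_seq.
  apply: eq_bigr => m ms; have mG : m \in Gamma b := allP (srange_Gamma b N) _ ms.
  (* The term [m = k] left out of the series costs nothing: on the right it carries the factor $i(k
     - m) = 0$. *)
  rewrite gY// /a mG /Vcoef /qcoef; case: eqVneq => [->|_] /=; first by ring.
  by rewrite intrD rmorphD /= mulrNz rmorphN /=; ring.
have c' : ccvg (symsum a) ('i * (k%:~R)%:C * fourier (fun x => Q x * Y x) k -
    fourier (fun x => Q x * g x) k).
  by have -> : symsum a = _ := funext aE.
by apply: complex_ext; rewrite /zseries /=; apply: cvg_lim => //; [exact: c'.1|exact: c'.2].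
Qed.

End periodic_operators.

(** * Square-summable coefficients and the two inclusions between the domains *)

Section domains.
Variable R : realType.
Local Notation mu := (@lebesgue_measure R).
Local Notation Re := (@complex.Re R).
Local Notation Im := (@complex.Im R).
Local Notation D := (`[0%R, pi]%classic : set R).
Local Notation mD := (@measurable_0pi R).
Local Notation emi := (@emi R).
Local Notation norm2 := (norm2 D).
Implicit Types (f g h Y Q y : R -> R[i]) (k : int) (b : bool).

(** Sums over the index set are suprema over finite subsets; duplicate-free lists are the form in
    which Bessel's inequality is available. *)
Lemma esum_lty (W : int -> R) b (C : R) : (forall k, 0 <= W k) ->
  (forall s, uniq s -> all (mem (Gamma b)) s -> \sum_(k <- s) W k <= C) ->
  (\esum_(k in Gamma b) (W k)%:E < +oo)%E.
Proof.
move=> W0 WC; apply: (@le_lt_trans _ _ C%:E); last exact: ltry.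
apply: ge_ereal_sup => _ [A [fA AG] <-].
rewrite fsbig_finite// sumEFin lee_fin; apply: WC; first exact: finmap.fset_uniq.
by apply/allP => k; rewrite in_fset_set// => /set_mem /AG /mem_set.
Qed.

Lemma esum_bounded (W : int -> R) b : (forall k, 0 <= W k) ->
  (\esum_(k in Gamma b) (W k)%:E < +oo)%E ->
  exists C, forall s, uniq s -> all (mem (Gamma b)) s -> \sum_(k <- s) W k <= C.
Proof.
move=> W0 Wfin; exists (fine (\esum_(k in Gamma b) (W k)%:E)%E) => s us sG.
have e0 : (0 <= \esum_(k in Gamma b) (W k)%:E)%E by apply: esum_ge0 => k _; rewrite lee_fin.
rewrite -lee_fin fineK ?ge0_fin_numE//.
apply: esum_ge; exists [set` s].
  split; first exact: finite_seq.
  by move=> k /= /(allP sG) /set_mem.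
by rewrite -fsbig_seq// sumEFin.
Qed.

Lemma bessel_ell2 b f : L2on D f -> ell2 b (fourier f).
Proof.
move=> If; apply: (@esum_lty _ b (norm2 f / pi)) => [k|s us sG]; first exact: csq_ge0.
by rewrite ler_pdivlMr ?pi_gt0// mulrC; exact: bessel us sG If.
Qed.

Lemma ell2_le b (W : int -> R) (a : int -> R[i]) :
  (\esum_(k in Gamma b) (W k)%:E < +oo)%E -> (forall k, csq (a k) <= W k) -> ell2 b a.
Proof.
move=> Wfin aW; apply: le_lt_trans Wfin; apply: le_esum => k _.
by rewrite lee_fin.
Qed.

Lemma ell2_fourier b (a : int -> R[i]) : ell2 b a ->
  exists2 f, L2on D f & forall k, k \in Gamma b -> fourier f k = a k.
Proof.
move=> /esum_bounded[k|C hC]; first exact: csq_ge0.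
have [f [If fa _]] : exists f, [/\ L2on D f, forall k, k \in Gamma b -> fourier f k = a k &
    forall e, 0 < e -> exists N, norm2 (fun x => f x - trig a (srange b N) x) <= e].
  by apply: (@riesz_fischer _ b a C) => N; apply: hC; [exact: srange_uniq|exact: srange_Gamma].
by exists f.
Qed.

Lemma eq_ell2 b (a a' : int -> R[i]) : (forall k, k \in Gamma b -> a k = a' k) ->
  ell2 b a -> ell2 b a'.
Proof.
by move=> aa'; rewrite /ell2 (@eq_esum _ _ _ _ (fun k => (csq (a' k))%:E))// => k /mem_set /aa' ->.
Qed.

Lemma bsign_sqr b : bsign R b * bsign R b = 1.
Proof. by case: b; rewrite /bsign; ring. Qed.

Lemma fourier_primitive b Y g k : L1on D g -> primitive_on Y g ->
  Y pi = bsign R b * Y 0 -> k \in Gamma b ->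
  fourier g k = 'i * (k%:~R)%:C * fourier Y k.
Proof.
move=> Ig Yg Ypi kG; have := cint_by_parts k Ig Yg.
rewrite (emi_pi_Gamma R kG) Ypi [bsign R b * Y 0 * _]mulrAC bsign_sqr mul1r subrr add0r.
rewrite !cint_fourier => h; apply: (mulfI (realC_neq0 (@pi_neq0 R))).
by rewrite h [RHS]mulrCA.
Qed.

Lemma primitive_addcst g (z : R[i]) : primitive_on (fun x => z + cint `[0%R, x] g) g.
Proof. by move=> x _; rewrite set_itv1 cint_set1 addr0. Qed.

(** At [k != 0] the coefficients of any primitive meeting the endpoint condition are forced by
    division by $ik$; only the constant of integration remains to be chosen. *)
Lemma exists_primitive b g (a : int -> R[i]) : L1on D g ->
  (forall k, k \in Gamma b -> fourier g k = 'i * (k%:~R)%:C * a k) ->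
  exists Y, [/\ primitive_on Y g, Y pi = bsign R b * Y 0 &
    forall k, k \in Gamma b -> fourier Y k = a k].
Proof.
move=> Ig ga.
have IG := L2on_L1on (primitive_L2on Ig (primitive_cint g)).
(* Periodic case: the constant matches the zeroth coefficient, and the endpoint condition holds
   because [g] has integral zero. Antiperiodic case: it solves $z + \int g = -z$, and there is no
   zeroth frequency to match. *)
pose z : R[i] := if b then a 0 - fourier (fun x => cint `[0%R, x] g) 0 else - cint D g / 2%:R.
pose Y x : R[i] := z + cint `[0%R, x] g.
have YP : primitive_on Y g := primitive_addcst g z.
have Y0 : Y 0 = z by rewrite /Y set_itv1 cint_set1 addr0.
have Ypi : Y pi = bsign R b * Y 0.
  rewrite Y0 /Y /z; case: (b) ga => ga /=; last by field.
  have -> : cint D g = 0.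
    have := cint_fourier g 0; rewrite ga ?mem_Gamma// mulr0 mul0r mulr0 => <-.
    by apply: eq_cint => x _; rewrite emi0 mulr1.
  by rewrite addr0 mul1r.
exists Y; split => // k kG.
have [k0|k0] := eqVneq k 0; last first.
  have := fourier_primitive Ig YP Ypi kG; rewrite ga// => /esym; apply: mulfI.
  rewrite mulf_neq0//; first by apply/eqP => /(congr1 Im)/= /eqP; rewrite oner_eq0.
  by apply: realC_neq0; rewrite intr_eq0.
move: kG; rewrite k0 => G0; rewrite fourierD//; last exact/L2on_L1on/L2on_cst.
have bT : b = true by move: G0; rewrite mem_Gamma; case: (b).
by rewrite fourier_cst ?mem_Gamma// eqxx /z bT subrK.
Qed.

Lemma L2on_Mprimitive Q Y g : L2on D Q -> L1on D g -> primitive_on Y g -> L2on D (fun x => Q x * Y x).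
Proof.
move=> IQ Ig Yg; have [M M0 hM] := primitive_bounded Ig Yg.
apply: (L2on_Mbounded mD (M := M ^+ 2 + M ^+ 2) IQ (primitive_cmeas Ig Yg)) => x /hM[h1 h2].
by apply: lerD; rewrite -real_normK ?num_real// ler_sqr ?nnegrE//.
Qed.

Lemma fourier_lexpr_split C Q Y g w : L2on D Q -> L2on D Y -> L2on D g -> L1on D w ->
  forall k, fourier (lexpr C Q Y g w) k =
    - fourier w k - fourier (fun x => Q x * g x) k + C * fourier Y k.
Proof.
move=> IQ IY Ig Iw k.
have IQg := L1on_ML2 mD IQ Ig; have IY1 := L2on_L1on IY.
rewrite /lexpr fourierD; last exact: (L1onZ mD).
  by rewrite fourierB ?fourierN ?fourierZ//; exact: (L1onN mD).
by apply: (L1onB mD) => //; exact: (L1onN mD).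
Qed.

(** Here [c], [r], [s], [t], [z] stand for $k$, $Y_k$, $(QY)_k$, $(Qg)_k$, $C$; the only input
    beyond ring laws is $i^2 = -1$. *)
Lemma symbol_identity (c r s t z : R[i]) :
  - ('i * c * ('i * c * r - s)) - t + z * r = c * c * r + ('i * c * s - t) + z * r.
Proof.
have -> : c * c * r = - (('i * 'i) * (c * c * r)) by rewrite mulii; ring.
ring.
Qed.

Lemma fourier_lexpr b C Q y Y g u w k : L2on D Q -> L2on D y ->
  dom_witness b C Q y Y g u w -> k \in Gamma b ->
  fourier (lexpr C Q Y g w) k = hcoef b C Q (fourier y) k.
Proof.
move=> IQ Iy [[Ig YP yY] [[Iw uP uE] [[Ypi upi] _]]] kG.
have Ig1 := L2on_L1on Ig.
have IY := primitive_L2on Ig1 YP; have IQY := L2on_Mprimitive IQ Ig1 YP.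
have -> : fourier y = fourier Y.
  by apply/funext => m; apply: ae_eq_fourier => //; [have [] := Iy|have [] := IY].
have uF : fourier u k = fourier g k - fourier (fun x => Q x * Y x) k.
  rewrite -fourierB//; last exact: L2on_L1on.
  apply: ae_eq_fourier => //; first exact: primitive_cmeas Iw uP.
  by have [] := L2onB mD Ig IQY.
have gF m : m \in Gamma b -> fourier g m = 'i * (m%:~R)%:C * fourier Y m.
  exact: fourier_primitive Ig1 YP Ypi.
rewrite fourier_lexpr_split// (fourier_primitive Iw uP upi kG) uF /hcoef.
rewrite (zseries_Vcoef _ IQ IY Ig gF) gF//.
have -> : ((k%:~R : R) ^+ 2)%:C = (k%:~R)%:C * (k%:~R)%:C :> R[i] by rewrite expr2 rmorphM.
exact: symbol_identity.
Qed.

Lemma domL_domLL b C Q y : L2on D Q -> L2on D y ->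
  domL b C Q y -> domLL b C Q (fourier y).
Proof.
move=> IQ Iy [Y [g [u [w W]]]]; split; last first.
  have [_ [_ [_ Il]]] := W.
  by apply: eq_ell2 (bessel_ell2 b Il) => k; exact: fourier_lexpr W.
have [[Ig YP yY] [_ [[Ypi _] _]]] := W.
have Ig1 := L2on_L1on Ig; have IY := primitive_L2on Ig1 YP.
apply: (@esum_lty _ b (norm2 Y / pi + norm2 g / pi)) => [k|s us sG].
  by rewrite mulr_ge0 ?csq_ge0// addr_ge0 ?sqr_ge0.
(* Since $|g_k| = |k||Y_k|$, the weighted sum is bounded by Bessel for [Y] and for [g]. *)
have -> : \sum_(k <- s) (1 + k%:~R ^+ 2) * csq (fourier y k) =
    \sum_(k <- s) csq (fourier Y k) + \sum_(k <- s) csq (fourier g k).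
  rewrite -big_split [LHS]big_seq [RHS]big_seq; apply: eq_bigr => k ks.
  have kG : k \in Gamma b := allP sG _ ks.
  have -> : fourier y k = fourier Y k.
    by apply: ae_eq_fourier => //; [have [] := Iy|have [] := IY].
  rewrite (fourier_primitive Ig1 YP Ypi kG); move: (fourier Y k) => z.
  by rewrite !csqM csqi csqR mul1r mulrDl mul1r.
by apply: lerD; rewrite ler_pdivlMr ?pi_gt0// mulrC; exact: bessel us sG _.
Qed.

Lemma domLL_domL b C Q y : L2on D Q -> L2on D y ->
  domLL b C Q (fourier y) -> domL b C Q y.
Proof.
move=> IQ Iy [yk yh].
have [g Ig gF] : exists2 g, L2on D g &
    forall k, k \in Gamma b -> fourier g k = 'i * (k%:~R)%:C * fourier y k.
  apply: ell2_fourier; apply: ell2_le yk _ => k.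
  move: (fourier y k) => z; rewrite !csqM csqi csqR mul1r ler_wpM2r ?csq_ge0//.
  by rewrite lerDr.
have [f If fF] := ell2_fourier yh.
have Ig1 := L2on_L1on Ig.
have [Y [YP Ypi YF]] := exists_primitive Ig1 gF.
have IY := primitive_L2on Ig1 YP; have IQY := L2on_Mprimitive IQ Ig1 YP.
have yY : {ae mu, forall x, D x -> y x = Y x}.
  have : {ae mu, forall x, D x -> y x - Y x = 0}.
    apply: (@fourier_eq0 _ b); first exact: (L2onB mD).
    by move=> k kG; rewrite fourierB ?YF ?subrr//; exact: L2on_L1on.
  by apply: lebesgue_aeS => x /[apply] /eqP; rewrite subr_eq0 => /eqP.
have yF : fourier y = fourier Y.
  by apply/funext => m; apply: ae_eq_fourier => //; [have [] := Iy|have [] := IY].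
pose w x := - f x - Q x * g x + C * Y x.
have IQg := L1on_ML2 mD IQ Ig; have IY1 := L2on_L1on IY; have If1 := L2on_L1on If.
have INf := L1onN mD If1.
have Iw : L1on D w by apply: (L1onD mD); [exact: (L1onB mD)|exact: (L1onZ mD)].
have lE : lexpr C Q Y g w = f by apply/funext => x; rewrite /lexpr /w; ring.
(* The equation $f_k = h_k(z)$ solved for the coefficients of [w]. It is the hypothesis of
   [exists_primitive], which then supplies both the boundary condition and the coefficients of
   [u]. *)
have wF k : k \in Gamma b -> fourier w k =
    'i * (k%:~R)%:C * (fourier g k - fourier (fun x => Q x * Y x) k).
  move=> kG; have -> : fourier w k = - fourier f k - fourier (fun x => Q x * g x) k + C * fourier Y k.
    exact: fourier_lexpr_split.
  have gFY m : m \in Gamma b -> fourier g m = 'i * (m%:~R)%:C * fourier Y m.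
    by move=> mG; rewrite gF// yF.
  rewrite fF// yF /hcoef (zseries_Vcoef _ IQ IY Ig gFY) gFY//.
  have -> : ((k%:~R : R) ^+ 2)%:C = (k%:~R)%:C * (k%:~R)%:C :> R[i] by rewrite expr2 rmorphM.
  by rewrite -symbol_identity; ring.
have [u [uP upi uF]] := exists_primitive Iw wF.
have Iu := primitive_L2on Iw uP.
exists Y, g, u, w; split; first by split.
split; last by split => //; rewrite lE.
split => //.
have IgQ := L2onB mD Ig IQY.
(* Both sides have the same coefficients over [Gamma b], so uniqueness identifies [u] with the
   quasi-derivative. *)
have : {ae mu, forall x, D x -> u x - (g x - Q x * Y x) = 0}.
  apply: (@fourier_eq0 _ b); first exact: (L2onB mD).
  move=> k kG; rewrite fourierB ?uF; [|by []|exact: L2on_L1on|exact: L2on_L1on].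
  by rewrite fourierB ?subrr//; exact: L2on_L1on.
by apply: lebesgue_aeS => x /[apply] /eqP; rewrite subr_eq0 => /eqP.
Qed.

End domains.

(** The operator identity is expressed on coefficients: by [fourier_eq0] those over [Gamma plus]
    determine the square-integrable [lexpr C Q Y g w] almost everywhere, so every witness of [y]
    yields the same element of L2. *)
Theorem theorem11 (R : realType) (C : R[i]) (Q : R -> R[i]) (plus : bool)
  (HQper : forall x, Q (x + pi) = Q x)
  (HQloc : forall a b : R, L2on `[a, b] Q)
  (HQmean : cint `[0, pi] Q = 0)
  (y : R -> R[i]) (Hy : L2on `[0, pi] y) :
  (domL plus C Q y <-> domLL plus C Q (fourier y)) /\
  (forall Y g u w, dom_witness plus C Q y Y g u w ->
     forall k, k \in Gamma plus ->
       fourier (lexpr C Q Y g w) k = hcoef plus C Q (fourier y) k).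
Proof.
have IQ := HQloc 0 pi; split.
  by split; [exact: domL_domLL|exact: domLL_domL].
by move=> Y g u w W k kG; exact: fourier_lexpr W kG.
Qed.
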